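(* Let $j \geq 2$ and $N \geq 2$ be integers. Let $f : (0, \infty) \to \mathbb{R}$ be a function such that $$f(\lambda_j(t K + (1 - t)L)) \geq t f(\lambda_j(K)) + (1 - t) f(\lambda_j(L))$$ for all convex bodies $K, L \subset \mathbb{R}^{N}$ and all $t \in [0, 1]$. Then $f$ is constant.
   Context: A convex body in $\mathbb{R}^N$ is a compact convex subset of $\mathbb{R}^N$ with nonempty interior. For a convex body $K$, $\lambda_j(K) := \lambda_j(\mathrm{int}\, K)$ denotes the $j$th eigenvalue of the Dirichlet Laplacian $-\Delta$ on the interior of $K$, where the eigenvalues are listed in nondecreasing order, counted with multiplicity, with indices starting at $1$. The set $tK + (1-t)L = \{tx + (1-t)y : x \in K,\ y \in L\}$ is the Minkowski combination. *)

(* Defs.v *)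
From HB Require Import structures.
From mathcomp Require Import all_boot all_order all_algebra.
From mathcomp Require Import all_classical all_reals all_analysis.

Set Implicit Arguments.
Unset Strict Implicit.
Unset Printing Implicit Defensive.

Import Order.TTheory GRing.Theory Num.Theory.
Import numFieldNormedType.Exports.

Local Open Scope classical_set_scope.
Local Open Scope ring_scope.

(** * Lebesgue measure on [R^n], realized as row vectors *)

(** The sigma-algebra on [R^n] generated by the coordinate maps, i.e. the
    Borel sigma-algebra. *)
Section measurable_rV.
Context {R : realType} (n : nat).

Definition rV_coord : 'I_n -> 'rV[R]_n -> R := fun i x => x 0 i.

Let rV_set0 : g_sigma_preimage rV_coord set0.
Proof. exact: sigma_algebra0. Qed.

Let rV_setC A : g_sigma_preimage rV_coord A -> g_sigma_preimage rV_coord (~` A).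
Proof. exact: sigma_algebraC. Qed.

Let rV_bigcup (F : (set 'rV[R]_n)^nat) :
  (forall i, g_sigma_preimage rV_coord (F i)) ->
  g_sigma_preimage rV_coord (\bigcup_i F i).
Proof. exact: sigma_algebra_bigcup. Qed.

HB.instance Definition _ := @isMeasurable.Build default_measure_display
  'rV[R]_n (g_sigma_preimage rV_coord) rV_set0 rV_setC rV_bigcup.

End measurable_rV.

(* The library's sigma-finite instance on [\x] is shadowed by the one for
   subprobabilities. *)
Lemma sigma_finite_product_measure1 d1 d2 (T1 : measurableType d1)
    (T2 : measurableType d2) (R : realType)
    (m1 : {sigma_finite_measure set T1 -> \bar R})
    (m2 : {sigma_finite_measure set T2 -> \bar R}) :
  sigma_finite setT (m1 \x m2)%E.
Proof.
have /sigma_finiteP[F [TF ndF Foo]] := sigma_finiteT m1.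
have /sigma_finiteP[G [TG ndG Goo]] := sigma_finiteT m2.
exists (fun n => F n `*` G n) => [|k].
  rewrite -setXTT TF TG predeqE => -[x y]; split.
    move=> [/= [n _ Fnx] [k _ Gky]]; exists (maxn n k) => //; split.
    - by move: x Fnx; exact/subsetPset/ndF/leq_maxl.
    - by move: y Gky; exact/subsetPset/ndG/leq_maxr.
  by move=> [n _ []/= ? ?]; split; exists n.
have [? ?] := Foo k; have [? ?] := Goo k; split; first exact: measurableX.
by rewrite product_measure1E// lte_mul_pinfty// ge0_fin_numE.
Qed.

Section lebesgue_rV.
Context {R : realType}.

Definition rV_cons (n : nat) (p : R * 'rV[R]_n) : 'rV[R]_n.+1 :=
  row_mx p.1%:M p.2.

Definition rV_uncons (n : nat) (x : 'rV[R]_n.+1) : R * 'rV[R]_n :=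
  (x 0 ord0, \row_i x 0 (lift ord0 i)).

Lemma rV_cons0 n (p : R * 'rV[R]_n) : rV_cons p 0 ord0 = p.1.
Proof.
rewrite (_ : ord0 = lshift n (ord0 : 'I_1)); last exact/val_inj.
by rewrite [LHS](@row_mxEl _ 1 1 n) mxE eqxx mulr1n.
Qed.

Lemma rV_consS n (p : R * 'rV[R]_n) i : rV_cons p 0 (lift ord0 i) = p.2 0 i.
Proof.
rewrite (_ : lift ord0 i = rshift 1 i); last exact/val_inj.
by rewrite [LHS](@row_mxEr _ 1 1 n).
Qed.

Lemma rV_consK n : cancel (@rV_cons n) (@rV_uncons n).
Proof.
move=> [a x]; rewrite /rV_uncons rV_cons0; congr pair.
by apply/rowP => i; rewrite mxE rV_consS.
Qed.

Lemma measurable_rV_coord n (i : 'I_n) :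
  measurable_fun [set: 'rV[R]_n] (rV_coord i).
Proof.
move=> _ Y mY; rewrite setTI; apply: sub_sigma_algebra => /=.
rewrite -bigcup_seq/=; exists i => /=; first by rewrite mem_index_enum.
by exists Y => //; rewrite setTI.
Qed.

Lemma measurable_fun_rVP d (T : measurableType d) n (f : T -> 'rV[R]_n) :
  (forall i, measurable_fun [set: T] (rV_coord i \o f)) ->
  measurable_fun [set: T] f.
Proof.
move=> mf.
suff h : preimage_set_system [set: T] f (g_sigma_preimage (@rV_coord R n))
    `<=` measurable.
  by move=> _ A mA; apply: h; exists A.
rewrite -g_sigma_preimage_comp.
apply: smallest_sub; first exact: sigma_algebra_measurable.
case: n => [|n] in f mf *; first by rewrite big_ord0.
rewrite -bigcup_mkord_ord; apply: bigcup_sub => i Ii.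
by move=> A [B mB <-]; exact: mf.
Qed.

Lemma measurable_rV_cons n :
  measurable_fun [set: R * 'rV[R]_n] (@rV_cons n).
Proof.
apply: measurable_fun_rVP => i.
have [j|] := @unliftP _ ord0 i => ->.
  rewrite (_ : _ \o _ = rV_coord j \o snd).
    by apply: measurableT_comp => //; exact: measurable_rV_coord.
  by apply/funext => p; exact: rV_consS.
rewrite (_ : _ \o _ = fst); first exact: measurable_fst.
by apply/funext => p; exact: rV_cons0.
Qed.

Lemma measurable_rV_uncons n :
  measurable_fun [set: 'rV[R]_n.+1] (@rV_uncons n).
Proof.
apply/measurable_fun_pairP; split; first exact: measurable_rV_coord.
apply: measurable_fun_rVP => i.
rewrite (_ : _ \o _ = rV_coord (lift ord0 i)); first exact: measurable_rV_coord.
by apply/funext => x; rewrite /rV_coord /= mxE.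
Qed.

Section step.
Variables (n : nat) (mu : {sigma_finite_measure set 'rV[R]_n -> \bar R}).

Definition lebesgue_rV_step : set 'rV[R]_n.+1 -> \bar R :=
  pushforward (@lebesgue_measure R \x mu)%E (@rV_cons n).

HB.instance Definition _ := Measure.copy lebesgue_rV_step
  (measure_function_pushforward__canonical__measure_function_Measure
    (@lebesgue_measure R \x mu)%E (@measurable_rV_cons n)).

Let lebesgue_rV_step_sigma_finite : sigma_finite setT lebesgue_rV_step.
Proof.
have [F UF mF] := sigma_finite_product_measure1 (@lebesgue_measure R) mu.
exists (fun i => @rV_uncons n @^-1` F i) => [|i].
  by rewrite -preimage_bigcup -UF preimage_setT.
have [mFi Foo] := mF i; split.
  by rewrite -[X in measurable X]setTI; exact: measurable_rV_uncons.
rewrite /lebesgue_rV_step /pushforward -comp_preimage.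
rewrite (_ : _ \o _ = id) ?preimage_id//.
by apply/funext => p /=; rewrite rV_consK.
Qed.

HB.instance Definition _ := Measure_isSigmaFinite.Build _ _ _
  lebesgue_rV_step lebesgue_rV_step_sigma_finite.

End step.

Fixpoint lebesgue_rV (n : nat) : {sigma_finite_measure set 'rV[R]_n -> \bar R} :=
  match n with
  | 0 => \d_(0 : 'rV[R]_0)
  | m.+1 => lebesgue_rV_step (lebesgue_rV m)
  end.

End lebesgue_rV.

(** * Dirichlet eigenvalues *)

Section dirichlet.
Context {R : realType} {N : nat}.
Implicit Types (Omega : set 'rV[R]_N) (u phi : 'rV[R]_N -> R).

Definition partial (i : 'I_N) phi : 'rV[R]_N -> R :=
  fun x => 'D_(delta_mx 0 i) phi x.

Definition smooth phi := forall s : seq 'I_N,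
  continuous (foldr partial phi s) /\
  forall i x, derivable (foldr partial phi s) x (delta_mx 0 i).

Definition support phi : set 'rV[R]_N := closure [set x | phi x != 0].

(** [C_c^oo(Omega)] *)
Definition test_function Omega phi :=
  [/\ smooth phi, compact (support phi) & support phi `<=` Omega].

Definition square_integrable Omega u :=
  measurable_fun Omega u /\
  (\int[lebesgue_rV N]_(x in Omega) ((u x) ^+ 2)%:E < +oo)%E.

Definition L2_cvg Omega (v : ('rV[R]_N -> R)^nat) u :=
  (fun n => \int[lebesgue_rV N]_(x in Omega) ((v n x - u x) ^+ 2)%:E)%E
    @ \oo --> 0%E.

(** [u] belongs to [H^1_0(Omega)], the closure of [C_c^oo(Omega)] for the
    [H^1] norm, and [G] is its weak gradient (the [L^2] limit of the gradients
    of an approximating sequence; it is determined a.e. by [u]). *)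
Definition H10 Omega u (G : 'I_N -> 'rV[R]_N -> R) :=
  [/\ square_integrable Omega u,
      forall i, square_integrable Omega (G i) &
      exists phi : ('rV[R]_N -> R)^nat,
        [/\ forall n, test_function Omega (phi n),
            L2_cvg Omega phi u &
            forall i, L2_cvg Omega (fun n => partial i (phi n)) (G i)]].

(** [u] is in [H^1_0(Omega)] and [- Delta u = mu u] in the sense of
    distributions; [u = 0] is allowed, so that these functions form the
    eigenspace of [mu] (which is trivial unless [mu] is an eigenvalue). *)
Definition dirichlet_eigenfunction Omega (mu : R) u :=
  exists2 G, H10 Omega u G &
    forall phi, test_function Omega phi ->
      \int[lebesgue_rV N]_(x in Omega) (\sum_(i < N) G i x * partial i phi x) =
      mu * \int[lebesgue_rV N]_(x in Omega) (u x * phi x).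

Definition ae_free Omega k (u : 'I_k -> 'rV[R]_N -> R) :=
  forall c : 'I_k -> R,
    {ae lebesgue_rV N, forall x, Omega x -> \sum_(i < k) c i * u i x = 0} ->
    forall i, c i = 0.

Definition eigenspace_dim_ge Omega (mu : R) (k : nat) :=
  exists u : 'I_k -> 'rV[R]_N -> R,
    (forall i, dirichlet_eigenfunction Omega mu (u i)) /\ ae_free Omega u.

Definition eigenspace_dim Omega (mu : R) (k : nat) :=
  eigenspace_dim_ge Omega mu k /\ ~ eigenspace_dim_ge Omega mu k.+1.

(** [lam 0 <= lam 1 <= ...] lists all the eigenvalues of the Dirichlet
    Laplacian on [Omega], each one repeated according to its multiplicity. *)
Definition dirichlet_spectrum Omega (lam : R^nat) :=
  {homo lam : m n / (m <= n)%N >-> m <= n} /\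
  forall mu, exists2 k, eigenspace_dim Omega mu k &
                        ([set n | lam n = mu] #= `I_k)%card.

(** The [j]-th Dirichlet eigenvalue, for [j >= 1]. There is at most one
    sequence satisfying [dirichlet_spectrum Omega], and there is one when
    [Omega] is bounded, open and nonempty in dimension [N >= 1]; the default value
    of [xget] is then irrelevant. *)
Definition dirichlet_eigenvalue Omega (j : nat) : R :=
  xget (fun=> 0) [set lam : R^nat | dirichlet_spectrum Omega lam] j.-1.

Definition convex_body (K : set 'rV[R]_N) :=
  [/\ compact K, convex_set (K : set (convex_lmodType 'rV[R]_N)) &
      K^° !=set0].

Definition body_eigenvalue (j : nat) (K : set 'rV[R]_N) : R :=
  dirichlet_eigenvalue K^° j.

Definition minkowski_comb (t : R) (K L : set 'rV[R]_N) : set 'rV[R]_N :=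
  [set t *: x + (1 - t) *: y | x in K & y in L].

End dirichlet.

(* Main.v *)
Require Import Defs.
From mathcomp Require Import all_boot all_order all_algebra fingroup perm.
From mathcomp Require Import all_classical all_reals all_analysis.
From mathcomp Require Import measurable_realfun ring lra.

(** Only axis-parallel boxes are used. Their spectrum is explicit, and closed
    boxes are stable under Minkowski combinations, the sides being combined
    linearly.

    Suppose that two boxes have the same [j]-th eigenvalue [x], and that some
    Minkowski combination of them has the [j]-th eigenvalue [y]. The hypothesis
    gives [f x <= f y]; rescaling the boxes gives [f (r * x) <= f (r * y)] for
    every [r > 0] ([box_comb_le]), that is [f z <= f (rho * z)] for all [z > 0]
    with [rho = y / x]. It remains to find ratios on both sides of [1].

    - A ratio [rho < 1] ([expand_down]): a box with one very short and one long
      side, and the same box with these two sides exchanged, have the same,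
      large, [j]-th eigenvalue, while their midpoint is a cube. This is the
      behaviour predicted by the Brunn-Minkowski inequality.
    - All the ratios in some interval [[1, rho1]] with [rho1 > 1]
      ([expand_up]): here [j >= 2] enters. When the sides other than the first
      two are small, the [j]-th eigenvalue is the smaller of the energies of the
      modes [(j, 1, 1, ...)] and [(1, 2, 1, ...)]. Choose the first two sides so
      that these two energies agree. Lengthening the first side and shortening
      the second lowers the energy of the first mode, and the opposite
      deformation lowers that of the second mode; both lower the [j]-th
      eigenvalue. The intermediate value theorem matches the two deformations so
      that they have the same [j]-th eigenvalue, and the crossing box is a
      Minkowski combination of the deformed ones ([crossing_boxes]).

    The second fact makes [f] nondecreasing on the positive reals; the first one
    gives [f x <= f (rho ^+ n * x)] with [rho ^+ n * x] as small as desired, so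
    [f x <= f y] for all positive [x] and [y]
    ([constant_of_multiplicative_bounds]).

    What takes room is the spectrum of a box for the weak formulation of the
    eigenvalue problem. The products of sines are eigenfunctions: they are the
    limits in [H^1] of smooth compactly supported functions, obtained with a
    cutoff built on [exp (- 1 / t)], and integration by parts on the box follows
    from the translation invariance of the Lebesgue measure. Testing the
    equation of an eigenfunction against the sine products shows that it is
    orthogonal to all those of a different energy ([eigenfunction_sin_prod]).
    The sine products are complete ([sin_prod_complete]): up to a factor
    [sin (pi x / a)], the polynomials in [cos (pi x / a)] have values in the
    span of the sines, and explicit polynomials converge boundedly to step
    functions; so a function orthogonal to the sine products has, once
    multiplied by the first of them, a zero integral over every orthant, hence
    over every measurable set. Thus each eigenspace has as many dimensions as
    there are modes with the given energy ([box_eigenspace_dim]), and the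
    eigenvalues are the energies of the modes, sorted
    ([dirichlet_eigenvalue_box]). *)

Set Implicit Arguments.
Unset Strict Implicit.
Unset Printing Implicit Defensive.

Import Order.TTheory GRing.Theory Num.Theory.
Import numFieldNormedType.Exports.

Local Open Scope classical_set_scope.
Local Open Scope ring_scope.

(** * Lebesgue measure on row vectors *)

Section measure_rV.
Context {R : realType}.

(** The measurable structure on row vectors is generated by the coordinates,
    whereas continuity refers to the sup norm. An open set is a countable union of
    cubes with rational centre and radius [1/(k+1)], and such cubes are measurable. *)
Lemma rV_open_measurable n (A : set 'rV[R]_n) : open A -> measurable A.
Proof.
move=> oA.
pose B (p : 'rV[rat]_n * nat) : set 'rV[R]_n :=
  [set x | forall i, `|x 0 i - ratr (p.1 0 i)| < p.2.+1%:R^-1].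
have mB p : measurable (B p).
  rewrite (_ : B p = \bigcap_(i in [set: 'I_n])
    (rV_coord i @^-1` [set y | `|y - ratr (p.1 0 i)| < p.2.+1%:R^-1])).
    apply: fin_bigcap_measurable => // i _.
    rewrite -[X in measurable X]setTI; apply: measurable_rV_coord => //.
    apply: open_measurable.
    rewrite (_ : [set _ | _] = ball (ratr (p.1 0 i) : R) p.2.+1%:R^-1).
      exact: ball_open.
    by apply/seteqP; split => y /=; rewrite /ball /= distrC.
  by apply/seteqP; split => x /= h i; [move=> _|]; exact: h.
rewrite (_ : A = \bigcup_(p : 'rV[rat]_n * nat) (if pselect (B p `<=` A) then B p else set0)).
  apply: countable_bigcupT_measurable; first exact: countableP.
  by move=> p; case: pselect => //= _; exact: mB.
apply/seteqP; split; last by move=> x [p _]; case: pselect => // h /h.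
move=> x Ax; have /nbhs_ballP[e /= e0 eA] : nbhs x A by exact: open_nbhs_nbhs.
have [k _ hk] := near_infty_natSinv_lt (PosNum (divr_gt0 e0 (ltr0Sn R 1))).
have /(_ k (leqnn k)) /= ke := hk.
have k0 : 0 < k.+1%:R^-1 :> R by rewrite invr_gt0.
have : forall i, exists q : rat, `|x 0 i - ratr q| < k.+1%:R^-1.
  move=> i; have := @rat_in_itvoo R (x 0 i) (x 0 i + k.+1%:R^-1).
  rewrite ltrDl => /(_ k0)[q]; rewrite /= in_itv /= => /andP[q1 q2].
  by exists q; rewrite distrC gtr0_norm ?subr_gt0// ltrBlDl.
move=> /choice[q hq].
have Bx : B (\row_i q i, k) x by move=> i; rewrite /= mxE; exact: hq.
exists (\row_i q i, k) => //; case: pselect => //= -[].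
move=> y By; apply: eA; split => //= i j; rewrite ord1.
apply: (le_lt_trans (ler_distD (ratr (q j)) _ _)).
rewrite (splitr e) ltrD//; first exact: (lt_trans (hq j) ke).
by rewrite distrC; have := By j; rewrite /= mxE => /lt_trans; exact.
Qed.

Lemma rV_continuous_measurable n (f : 'rV[R]_n -> R) :
  continuous f -> measurable_fun [set: 'rV[R]_n] f.
Proof.
move=> cf; apply: (measurability _ (RGenOpens.measurableE R)).
move=> _ [_ [a [b ->] <-]]; rewrite setTI; apply: rV_open_measurable.
by move/continuousP : cf; apply; exact: interval_open.
Qed.

Definition rV_box n (a : 'I_n -> R) : set 'rV[R]_n :=
  [set x | forall i, 0 < x 0 i < a i].

Lemma rV_box_measurable n (a : 'I_n -> R) : measurable (rV_box a).
Proof.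
rewrite (_ : rV_box a = \bigcap_(i in [set: 'I_n])
    (rV_coord i @^-1` `]0, a i[%classic)).
  apply: fin_bigcap_measurable => // i _.
  by rewrite -[X in measurable X]setTI; exact: measurable_rV_coord.
by apply/seteqP; split => x /= h i => [_|]; have := h i; rewrite /rV_coord/= in_itv//=; exact.
Qed.

Lemma lebesgue_rV_box n (a : 'I_n -> R) : (forall i, 0 <= a i) ->
  lebesgue_rV n (rV_box a) = (\prod_i a i)%:E.
Proof.
elim: n a => [|n IH] a a0.
  rewrite big_ord0 /= diracE mem_set// => -[]//.
rewrite /= /lebesgue_rV_step /pushforward.
rewrite (_ : _ @^-1` _ = `]0, a ord0[%classic `*` rV_box (fun i => a (lift ord0 i))).
  rewrite product_measure1E//; last exact: rV_box_measurable.
  rewrite IH//= lebesgue_measure_itv /= big_ord_recl EFinM lte_fin.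
  have := a0 ord0; rewrite le_eqVlt => /predU1P[<-|->].
    by rewrite ltxx.
  by rewrite oppr0 adde0.
apply/seteqP; split => -[y x] /=; rewrite in_itv /=.
  move=> h; split; first by have := h ord0; rewrite rV_cons0.
  by move=> i; have := h (lift ord0 i); rewrite rV_consS.
move=> [h1 h2] i; have [j|] := @unliftP _ ord0 i => ->.
  by rewrite rV_consS; exact: h2.
by rewrite rV_cons0.
Qed.

Lemma measurable_rV_shift n (v : 'rV[R]_n) :
  measurable_fun [set: 'rV[R]_n] (fun x => x + v).
Proof.
apply: measurable_fun_rVP => i.
rewrite (_ : _ \o _ = (fun x => rV_coord i x + v 0 i)).
  by apply: measurable_funD => //; exact: measurable_rV_coord.
by apply/funext => x; rewrite /rV_coord /= mxE.
Qed.

Lemma lebesgue_measure_shift (c : R) (A : set R) : measurable A ->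
  lebesgue_measure ((fun x => x + c) @^-1` A) = lebesgue_measure A.
Proof.
have mc : measurable_fun [set: measurableTypeR R]
    ((fun x => x + c) : measurableTypeR R -> measurableTypeR R).
  by apply: measurable_funD.
move=> mA; apply/esym.
pose mu := measure_function_pushforward__canonical__measure_function_Measure
  (@lebesgue_measure R) mc.
transitivity (mu A); last by [].
refine (@lebesgue_measure_unique R mu _ A mA) => _ [[a b] /= _ <-].
rewrite /mu /= /pushforward.
rewrite (_ : _ @^-1` _ = `]a - c, b - c]%classic).
  rewrite !lebesgue_measure_itv /= !lte_fin ltrD2r.
  by case: ifP => // _; rewrite -!EFinB; congr EFin; rewrite opprB addrA subrK.
by apply/seteqP; split => x /=; rewrite !in_itv /= lerBrDr ltrBlDr.
Qed.

(** The measure is an iterated product, so that translation invariance passes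
    from the line to row vectors by induction: the translate of the product measure
    agrees with it on rectangles. *)
Lemma lebesgue_rV_shift n (v : 'rV[R]_n) (A : set 'rV[R]_n) : measurable A ->
  lebesgue_rV n ((fun x => x + v) @^-1` A) = lebesgue_rV n A.
Proof.
elim: n v A => [|n IH] v A mA.
  suff -> : (fun x => x + v) @^-1` A = A by [].
  by apply/funext => x /=; rewrite (thinmx0 (x + v)) (thinmx0 x).
pose v' := \row_i v 0 (lift ord0 i).
pose tau (p : measurableTypeR R * 'rV[R]_n) : measurableTypeR R * 'rV[R]_n :=
  (p.1 + v 0 ord0, p.2 + v').
have mtau : measurable_fun [set: measurableTypeR R * 'rV[R]_n] tau.
  apply/measurable_fun_pairP; split.
    by apply: measurable_funD.
  rewrite (_ : _ \o _ = (fun x => x + v') \o snd)//.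
  by apply: measurableT_comp; [exact: measurable_rV_shift|].
rewrite /= /lebesgue_rV_step /pushforward.
set B := rV_cons (n := n) @^-1` A.
have mB : measurable B.
  by rewrite -[B]setTI; exact: measurable_rV_cons.
rewrite (_ : _ @^-1` _ = tau @^-1` B).
  pose mu := measure_function_pushforward__canonical__measure_function_Measure
    (@lebesgue_measure R \x lebesgue_rV n)%E mtau.
  apply/esym; refine (@product_measure_unique _ _ _ _ R (@lebesgue_measure R)
    (lebesgue_rV n) mu _ B mB) => X Y mX mY.
  rewrite /mu /= /pushforward.
  rewrite (_ : _ @^-1` _ = ((fun x => x + v 0 ord0) @^-1` X) `*` ((fun x => x + v') @^-1` Y))//.
  rewrite product_measure1E//.
  - by rewrite IH//; congr (_ * _)%E; exact: lebesgue_measure_shift.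
  - by rewrite -[X in measurable X]setTI; apply: measurable_funD.
  - by rewrite -[X in measurable X]setTI; exact: measurable_rV_shift.
apply/seteqP; split => -[x y] /=; rewrite /B /=;
  set w := (_ + v); rewrite (_ : w = rV_cons (tau (x, y)))//;
  apply/rowP => i; rewrite /w mxE; have [j|] := @unliftP _ ord0 i => ->;
  by rewrite ?rV_consS ?rV_cons0 //= !mxE.
Qed.
End measure_rV.

(** * Convergence of integrals over a set of finite measure *)

Section finite_measure_integrals.
Context d (T : measurableType d) (R : realType).
Variables (mu : {measure set T -> \bar R}) (D : set T).
Hypotheses (mD : measurable D) (finD : (mu D < +oo)%E).

Let L2 (u : T -> R) := measurable_fun D u /\
  (\int[mu]_(x in D) ((u x) ^+ 2)%:E < +oo)%E.

(** On a set of finite measure these functions are the convenient multipliers: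
    they are square integrable, and stay integrable when multiplied by an integrable
    function. *)
Definition bounded_mfun (g : T -> R) :=
  measurable_fun D g /\ exists M : R, forall x, D x -> `|g x| <= M.

Lemma bounded_on_le (g : T -> R) (M : R) : (forall x, D x -> `|g x| <= M) ->
  [bounded g x | x in D].
Proof.
move=> gM; exists M; split; first exact: num_real.
by move=> y My x Dx /=; rewrite (le_trans (gM _ Dx))// ltW.
Qed.

Lemma bounded_mfun_integrable g : bounded_mfun g -> mu.-integrable D (EFin \o g).
Proof.
move=> [mg [M gM]]; apply: measurable_bounded_integrable => //.
exact: bounded_on_le gM.
Qed.

Lemma bounded_mfunM f g : bounded_mfun f -> bounded_mfun g ->
  bounded_mfun (fun x => f x * g x).
Proof.
move=> [mf [M fM]] [mg [M' gM]]; split; first exact: measurable_funM.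
by exists (M * M') => x Dx; rewrite normrM ler_pM// ?fM ?gM.
Qed.

Lemma bounded_mfun_cst c : bounded_mfun (fun=> c).
Proof. by split; [exact: measurable_cst | exists `|c|]. Qed.

Lemma integrableM_bounded u g : mu.-integrable D (EFin \o u) -> bounded_mfun g ->
  mu.-integrable D (fun x => (u x * g x)%:E).
Proof.
move=> iu [mg [M gM]].
exact: (integrableMl mD iu mg (bounded_on_le gM)).
Qed.

Lemma square_integrable_bounded g : bounded_mfun g -> L2 g.
Proof.
move=> bg; split; first by case: bg.
have := bounded_mfun_integrable (bounded_mfunM bg bg).
move=> /integrableP[_]; apply: le_lt_trans.
rewrite (_ : (fun x => _) = (fun x => `|(EFin \o (fun x0 => (g x0 * g x0)%R)) x|)%E)//.
by apply/funext => x /=; rewrite ger0_norm -expr2 ?sqr_ge0.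
Qed.

(** On a set of finite measure, [|u| <= 1 + u ^ 2] is an integrable bound. *)
Lemma square_integrable_integrable u : L2 u -> mu.-integrable D (EFin \o u).
Proof.
move=> [mu_ u2].
have m2 : measurable_fun D (fun x => u x ^+ 2) by exact: measurable_funX.
have i2 : mu.-integrable D (EFin \o (fun x => u x ^+ 2)).
  apply/integrableP; split; first exact/measurable_EFinP.
  rewrite (_ : (fun x => _) = (fun x => (u x ^+ 2)%:E))//.
  by apply/funext => x /=; rewrite ger0_norm ?sqr_ge0.
have i1 := bounded_mfun_integrable (bounded_mfun_cst 1).
apply: le_integrable (integrableD mD i1 i2) => //; first exact/measurable_EFinP.
move=> x Dx /=; rewrite lee_fin [leRHS]ger0_norm ?addr_ge0 ?sqr_ge0//.
by rewrite ler_norml; apply/andP; split; have := sqr_ge0 (u x); nra.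
Qed.

Lemma Rintegral_bounded_cvg (u : T -> R) (g_ : (T -> R)^nat) (g : T -> R) (M : R) :
  mu.-integrable D (EFin \o u) ->
  (forall n, measurable_fun D (g_ n)) ->
  (forall n x, D x -> `|g_ n x| <= M) ->
  (forall x, D x -> g_ n x @[n --> \oo] --> g x) ->
  \int[mu]_(x in D) (u x * g_ n x) @[n --> \oo] --> \int[mu]_(x in D) (u x * g x).
Proof.
move=> iu mg gM gg.
have mu_ : measurable_fun D u by apply/measurable_EFinP/(measurable_int mu iu).
have mgl : measurable_fun D g by apply: measurable_fun_cvg gg.
have iU : mu.-integrable D (fun x => (u x * M)%:E).
  exact: (integrableM_bounded iu (bounded_mfun_cst M)).
have iU' : mu.-integrable D (fun x => `|(u x * M)%:E|)%E by exact: integrable_abse.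
have [| | | |i0 _ i1] := @dominated_convergence _ _ _ mu D mD
  (fun n x => (u x * g_ n x)%:E) (fun x => (u x * g x)%:E) (fun x => `|(u x * M)%:E|)%E _ _ _ iU' _.
- by move=> n; apply/measurable_EFinP; exact: measurable_funM.
- by apply/measurable_EFinP; exact: measurable_funM.
- apply: aeW => x Dx; apply/fine_cvgP; split; first exact: nearW.
  by apply: cvgMl_tmp; exact: gg.
- apply: aeW => x n Dx; rewrite /= lee_fin !normrM ler_wpM2l//.
  by rewrite (le_trans (gM n x Dx))// ler_norm.
apply: fine_cvg; rewrite fineK//; exact: integrable_fin_num.
Qed.

(** A cheap substitute for the Cauchy-Schwarz inequality:
    [C t <= C del + (C / del) t ^ 2] with [t = |v n - u|] reduces the claim to the
    convergence of the integral of [t ^ 2], for each fixed [del]. *)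
Lemma Rintegral_L2_cvg (v : (T -> R)^nat) u g :
  (forall n, L2 (v n)) -> L2 u -> bounded_mfun g ->
  (fun n => \int[mu]_(x in D) ((v n x - u x) ^+ 2)%:E)%E @ \oo --> 0%E ->
  \int[mu]_(x in D) (v n x * g x) @[n --> \oo] --> \int[mu]_(x in D) (u x * g x).
Proof.
move=> Lv Lu bg vu.
have iv n := square_integrable_integrable (Lv n).
have iu := square_integrable_integrable Lu.
have mv n : measurable_fun D (v n) by case: (Lv n).
have mu_ : measurable_fun D u by case: Lu.
have [mg [M gM]] := bg.
apply/cvgrPdist_le => e e0.
pose C : R := `|M| + 1; have C0 : 0 < C by rewrite /C; have := normr_ge0 M; lra.
pose m := fine (mu D); have m0 : 0 <= m by exact: fine_ge0.
(* [C * del * (m + 1) = e / 2] pays for the constant term, and the [L^2]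
   distance below pays for the other half of [e] *)
pose del := e / (2 * C * (m + 1)).
have del0 : 0 < del by rewrite divr_gt0// !mulr_gt0//; lra.
have h0 : 0 < e * del / (2 * C) by apply: divr_gt0; apply: mulr_gt0.
move/fine_cvgP : vu => [fin /cvgrPdist_le /(_ _ h0)] near0.
near=> n.
rewrite -RintegralB//; [|exact: integrableM_bounded..].
have fin_n : (\int[mu]_(x in D) ((v n x - u x) ^+ 2)%:E)%E \is a fin_num by near: n.
have sm : `|0 - fine (\int[mu]_(x in D) ((v n x - u x) ^+ 2)%:E)%E| <=
   e * del / (2 * C) by near: n.
have mvu : measurable_fun D (fun x => (v n x - u x) ^+ 2).
  by apply: measurable_funX; exact: measurable_funB.
have isq : mu.-integrable D (EFin \o (fun x => (v n x - u x) ^+ 2)).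
  apply/integrableP; split; first exact/measurable_EFinP.
  rewrite (_ : (fun x => _) = (fun x => ((v n x - u x) ^+ 2)%:E))//.
    by rewrite -ge0_fin_numE//; apply: integral_ge0 => x _; rewrite lee_fin sqr_ge0.
  by apply/funext => x /=; rewrite ger0_norm ?sqr_ge0.
have idiff : mu.-integrable D (EFin \o (fun x => u x * g x - v n x * g x)).
  rewrite (_ : _ \o _ = (fun x => (u x * g x)%:E - (v n x * g x)%:E)%E)//.
  by apply: integrableB => //; exact: integrableM_bounded.
have ibd : mu.-integrable D (EFin \o (fun x => C * del + (C / del) * (v n x - u x) ^+ 2)).
  apply: (integrableD mD (bounded_mfun_integrable (bounded_mfun_cst (C * del)))
    (integrableZl mD (C / del) isq)).
apply: (le_trans (le_normr_Rintegral mD idiff)).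
apply: (@le_trans _ _ (\int[mu]_(x in D) (C * del + (C / del) * (v n x - u x) ^+ 2))).
  apply: le_Rintegral => //; first exact: integrable_norm.
  move=> x Dx.
  rewrite -mulrBl normrM mulrC.
  have : `|g x| <= C by have := gM x Dx; have := ler_norm M; rewrite /C; lra.
  move=> /(ler_wpM2r (normr_ge0 (u x - v n x)))/le_trans; apply.
  rewrite -[X in _ <= _ + _ * X]real_normK ?num_real// distrC.
  set t := `|_|; have t0 : 0 <= t by exact: normr_ge0.
  have -> : C * del + C / del * t ^+ 2 = C * ((del ^+ 2 + t ^+ 2) / del).
    by field; rewrite gt_eqF.
  apply: ler_wpM2l; first exact: ltW.
  rewrite ler_pdivlMr//.
  by have := sqr_ge0 (t - del); nra.
rewrite RintegralD//; last 2 first.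
- exact: bounded_mfun_integrable (bounded_mfun_cst _).
- exact: (integrableZl mD (C / del) isq).
rewrite Rintegral_cst// RintegralZl//.
rewrite sub0r normrN ger0_norm in sm; last first.
  by rewrite fine_ge0// integral_ge0// => x _; rewrite lee_fin sqr_ge0.
have -> : e = C * del * m + C * del + C / del * (e * del / (2 * C)).
  rewrite /del; field; do ?[apply/andP; split]; try (by rewrite gt_eqF//); lra.
rewrite lerD//; first by rewrite lerDl mulr_ge0 ?ltW.
by rewrite ler_wpM2l// ltW// divr_gt0.
Unshelve. all: by end_near.
Qed.

Lemma L2_bounded_cvg (v : (T -> R)^nat) (u : T -> R) (M : R) :
  (forall n, measurable_fun D (v n)) -> measurable_fun D u ->
  (forall n x, D x -> `|v n x - u x| <= M) ->
  (forall x, D x -> v n x @[n --> \oo] --> u x) ->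
  (fun n => \int[mu]_(x in D) ((v n x - u x) ^+ 2)%:E)%E @ \oo --> 0%E.
Proof.
move=> mv mu_ vM vu.
have ic := bounded_mfun_integrable (bounded_mfun_cst (M ^+ 2)).
have [| | | |_ _ i1] := @dominated_convergence _ _ _ mu D mD
  (fun n x => ((v n x - u x) ^+ 2)%:E) (cst 0%E) (fun x => (M ^+ 2)%:E)%E _ _ _ ic _.
- by move=> n; apply/measurable_EFinP; apply: measurable_funX; exact: measurable_funB.
- exact: measurable_cst.
- apply: aeW => x Dx; apply/fine_cvgP; split; first exact: nearW.
  have h : v n x - u x @[n --> \oo] --> 0.
    by rewrite -(subrr (u x)); apply: cvgB; [exact: vu|exact: cvg_cst].
  by rewrite -[X in _ --> X](mul0r 0); exact: (cvgM h h).
- apply: aeW => x n Dx; rewrite /= lee_fin ger0_norm ?sqr_ge0//.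
  by rewrite -real_normK ?num_real// lerXn2r ?nnegrE// ?vM// (le_trans _ (vM n x Dx)).
by rewrite integral0 in i1.
Qed.

End finite_measure_integrals.

(** * Smooth functions of one variable and the cutoff sines *)

Section smooth1.
Context {R : realType}.
Implicit Types f g : R -> R.

(** Asking for the derivative as a function, instead of iterating the derivative
    operator, makes the stability under sums, products and composition a direct
    induction. *)
Fixpoint Cn n g : Prop := match n with
  | 0 => continuous g
  | m.+1 => exists g', (forall x, is_derive x (1 : R) g (g' x)) /\ Cn m g'
  end.

Lemma is_derive_continuous g g' : (forall x, is_derive x (1:R) g (g' x)) -> continuous g.
Proof.
move=> gg' x; apply: differentiable_continuous; apply/derivable1_diffP.
by have := gg' x => -[].
Qed.

Lemma CnW n g : Cn n.+1 g -> Cn n g.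
Proof.
elim: n g => [|n IH] g [g' [gg' cg']]; first exact: is_derive_continuous gg'.
by exists g'; split => //; exact: IH.
Qed.

Lemma Cn_cst n (c : R) : Cn n (fun=> c).
Proof.
elim: n c => [|n IH] c; first by move=> x; exact: cvg_cst.
by exists (fun=> 0); split => // x; exact: is_derive_cst.
Qed.

Lemma CnD n f g : Cn n f -> Cn n g -> Cn n (fun x => f x + g x).
Proof.
elim: n f g => [|n IH] f g; first by move=> cf cg x; apply: cvgD; [exact: cf|exact: cg].
move=> [f' [df cf]] [g' [dg cg]]; exists (fun x => f' x + g' x); split; last exact: IH.
by move=> x; exact: is_deriveD.
Qed.

Lemma CnM n f g : Cn n f -> Cn n g -> Cn n (fun x => f x * g x).
Proof.
elim: n f g => [|n IH] f g; first by move=> cf cg x; apply: cvgM; [exact: cf|exact: cg].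
move=> cf' cg'; have cf := CnW cf'; have cg := CnW cg'.
move: cf' cg' => [f' [df cf']] [g' [dg cg']].
exists (fun x => f x * g' x + g x * f' x); split.
  by move=> x; exact: is_deriveM.
by apply: CnD; exact: IH.
Qed.

Lemma Cn_comp n f g : Cn n f -> Cn n g -> Cn n (f \o g).
Proof.
elim: n f g => [|n IH] f g.
  by move=> cf cg x; apply: continuous_comp; [exact: cg|exact: cf].
move=> cf' cg'; have cg := CnW cg'.
move: cf' cg' => [f' [df cf']] [g' [dg cg']].
exists (fun x => f' (g x) * g' x); split.
  by move=> x; exact: is_derive1_comp.
by apply: CnM => //; exact: IH.
Qed.

Lemma Cn_id n : Cn n id.
Proof.
case: n => [|n]; first by move=> x; exact: cvg_id.
by exists (fun=> 1); split; [move=> x; exact: is_derive_id|exact: Cn_cst].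
Qed.

Lemma Cn_sin n : Cn n (@sin R).
Proof.
suff : Cn n (@sin R) /\ Cn n (@cos R) by case.
elim: n => [|n [IHs IHc]].
  by split=> x; [exact: continuous_sin|exact: continuous_cos].
split; first by exists cos; split => // x; exact: is_derive_sin.
exists (fun x => - sin x); split; first by move=> x; exact: is_derive_cos.
rewrite (_ : (fun x => _) = (fun x => -1 * sin x)).
  by apply: CnM => //; exact: Cn_cst.
by apply/funext => x; rewrite mulN1r.
Qed.

(** Functions [P (1 / t) exp (- 1 / t)] extended by zero: this class is stable
    under derivation, so all its members are smooth, in particular the case
    [P = 1]. *)
Definition chi (p : {poly R}) (t : R) : R :=
  if 0 < t then p.[t^-1] * expR (- t^-1) else 0.

(** The bound [expR s >= s ^ (d + 2) / (d + 2)!], with [d] the size of the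
    polynomial, leaves the factor [s ^ (- 2)], which is what differentiability of
    [chi] at [0] requires. *)
Lemma poly_expRN_bound (p : {poly R}) :
  exists2 C : R, 0 <= C & forall s, 1 <= s -> `|p.[s] * expR (- s)| <= C / s ^+ 2.
Proof.
exists ((\sum_(i < size p) `|p`_i|) * ((size p).+2)`!%:R).
  by rewrite mulr_ge0// sumr_ge0.
move=> s s1; have s0 : 0 < s by exact: lt_le_trans s1.
rewrite normrM [`|expR _|]ger0_norm ?expR_ge0// expRN.
rewrite ler_pdivrMr ?expR_gt0//.
have ps : `|p.[s]| <= (\sum_(i < size p) `|p`_i|) * s ^+ size p.
  rewrite horner_coef (le_trans (ler_norm_sum _ _ _))// mulr_suml ler_sum// => i _.
  rewrite normrM ler_wpM2l// normrX gtr0_norm// ler_weXn2l//.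
  exact/ltnW.
apply: (le_trans ps); rewrite -!mulrA ler_wpM2l ?sumr_ge0//.
have := expR_ge1Dxn (size p).+1 (ltW s0).
set F := _%:R => h.
have F0 : 0 < F :> R by rewrite ltr0n fact_gt0.
have {}h : s ^+ (size p).+2 / F <= expR s by lra.
rewrite mulrCA ler_pdivlMl ?exprn_gt0//.
by move: h; rewrite ler_pdivrMr// -[(size p).+2]/(2 + size p)%N exprD [expR s * F]mulrC.
Qed.

Lemma is_derive_chi p t : is_derive t (1:R) (chi p) (chi ('X^2 * (p - p^`())) t).
Proof.
have [t0|t0|->] := ltgtP t 0.
- rewrite /chi ltNge (ltW t0) /=.
  apply: (@near_eq_is_derive _ _ _ (fun=> 0 : R)).
  by near=> x; rewrite ltNge ltW//; near: x; exact: lt_nbhsl.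
- rewrite {2}/chi t0.
  have near_chi : \near t, p.[t^-1] * expR (- t^-1) = chi p t.
    by near=> x; rewrite /chi ifT//; near: x; exact: lt_nbhsr.
  have dV : is_derive t (1:R) (fun x : R => x^-1) (- t ^- 2 *: 1).
    by apply: is_deriveV; rewrite gt_eqF.
  have dp : is_derive t^-1 (1:R) (horner p) (p^`()).[t^-1].
    have := derivableP (derivable_horner (p := p) (x := t^-1)).
    by rewrite -derive1E -derivE.
  have d1 := is_derive1_comp dp dV.
  have dN : is_derive t (1:R) (fun x : R => - x^-1) (- (- t ^- 2 *: 1)) by exact: is_deriveN.
  have d2 := is_derive1_comp (g := fun x : R => - x^-1) (x := t)
    (is_derive_expR (- t^-1)) dN.
  refine (near_eq_is_derive near_chi _).
  apply: (is_derive_eq (is_deriveM d1 d2)).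
  rewrite /= hornerM hornerXn hornerD hornerN exprVn.
  rewrite /GRing.scale /=; ring.
- rewrite {2}/chi ltxx.
  have [C C0 hC] := poly_expRN_bound p.
  have H : (fun h => h^-1 *: ((chi p \o shift (0:R)) (h *: (1:R)) - chi p 0)) @ (0:R)^' --> (0:R).
    apply/cvgrPdist_le => e e0.
    near=> h.
    have h0 : h != 0 by near: h; exact: nbhs_dnbhs_neq.
    rewrite /= addr0 /GRing.scale /= mulr1 sub0r normrN /chi ltxx subr0.
    case: ifPn => hp; last by rewrite mulr0 normr0 ltW.
    have h1 : `|h| <= 1 by near: h; exact: dnbhs0_le.
    have h2 : `|h| <= e / (C + 1).
      by near: h; apply: dnbhs0_le; rewrite divr_gt0// ltr_wpDl.
    rewrite !gtr0_norm// in h1 h2.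
    rewrite normrM [`|h^-1|]gtr0_norm ?invr_gt0// ler_pdivrMl//.
    apply: (le_trans (hC h^-1 _)); first by rewrite invf_ge1.
    rewrite -exprVn invrK expr2 mulrCA ler_wpM2l ?ltW//.
    move: h2; rewrite ler_pdivlMr ?ltr_wpDl// => h2.
    by nra.
  by apply: DeriveDef; [apply/cvg_ex; exists 0|exact: cvg_lim].
Unshelve. all: by end_near.
Qed.

Lemma Cn_chi n p : Cn n (chi p).
Proof.
elim: n p => [|n IH] p.
  by apply: is_derive_continuous => x; exact: is_derive_chi.
by exists (chi ('X^2 * (p - p^`()))); split => // x; exact: is_derive_chi.
Qed.

Definition smooth1 g := forall n, Cn n g.

Lemma smooth1_derivable g x : smooth1 g -> derivable g x 1.
Proof. by move=> /(_ 1) [g' [/(_ x) []]]. Qed.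

Lemma smooth1_derive1 g : smooth1 g -> smooth1 (g^`())%classic.
Proof.
move=> sg n; have [g' [dg cg]] := sg n.+1.
suff -> : (g^`())%classic = g' by [].
by apply/funext => x; rewrite derive1E; have := dg x => -[].
Qed.

Lemma smooth1_continuous g : smooth1 g -> continuous g.
Proof. by move/(_ 0). Qed.
End smooth1.

Section cutoff.
Context {R : realType}.

Lemma norm_sin_le (y : R) : `|sin y| <= `|y|.
Proof.
have H (z : R) : 0 <= z -> `|sin z| <= z.
  move=> z0; have [|c _] := @MVT_segment R sin cos 0 z z0 (fun x _ => is_derive_sin x).
    by apply: continuous_subspaceT; exact: continuous_sin.
  rewrite sin0 !subr0 => ->; rewrite normrM (ger0_norm z0) -[leRHS]mul1r ler_wpM2r//.
  exact: cos_max.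
have [y0|y0] := leP 0 y; first by rewrite (ger0_norm y0); exact: H.
rewrite (ltr0_norm y0).
by rewrite -normrN -sinN; apply: H; rewrite oppr_ge0 ltW.
Qed.

(** Modes are indexed from [0], so that index [k] stands for [k + 1] half
    waves. *)
Definition freq (a : R) (k : nat) : R := k.+1%:R * pi / a.

Lemma freq_gt0 a k : 0 < a -> 0 < freq a k.
Proof. by move=> a0; rewrite divr_gt0// mulr_gt0// pi_gt0. Qed.

Lemma norm_sin_freq_refl (a : R) k x : 0 < a ->
  `|sin (freq a k * (a - x))| = `|sin (freq a k * x)|.
Proof.
move=> a0; rewrite (_ : freq a k * (a - x) = - (freq a k * x) + pi *+ k.+1).
  rewrite (alternatingn (@sinDpi R)) normrM normrX normrN normr1 expr1n mul1r.
  by rewrite sinN normrN.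
by rewrite /freq -mulr_natl; field; rewrite gt_eqF.
Qed.

(** The sine vanishes at both ends of [[0, a]], hence is bounded by the product
    of the distances to them. This factor compensates the derivative of the cutoff,
    which is large near the ends. *)
Lemma sin_freq_bound (a : R) k x : 0 < a -> 0 < x < a ->
  `|sin (freq a k * x)| <= 2 * freq a k / a * (x * (a - x)).
Proof.
move=> a0 /andP[x0 xa]; have f0 := freq_gt0 k a0.
have -> : 2 * freq a k / a * (x * (a - x)) = freq a k * (2 * (x * (a - x)) / a).
  by field; rewrite gt_eqF.
have h1 := norm_sin_le (freq a k * x).
have h2 := norm_sin_le (freq a k * (a - x)); rewrite norm_sin_freq_refl// in h2.
rewrite normrM (gtr0_norm f0) (gtr0_norm x0) in h1.
rewrite normrM (gtr0_norm f0) gtr0_norm ?subr_gt0// in h2.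
(* the nearer end of the interval gives the bound; the other factor is then at
   least [a / 2] *)
have [xh|xh] := leP (2 * x) a.
  apply: (le_trans h1); rewrite ler_pM2l// ler_pdivlMr//; nra.
apply: (le_trans h2); rewrite ler_pM2l// ler_pdivlMr//; nra.
Qed.

Let dchi : R -> R := chi ('X^2 * (1 - 1^`())).

Lemma dchiE t : 0 < t -> dchi t = t ^- 2 * expR (- t^-1).
Proof.
by move=> t0; rewrite /dchi /chi t0 derivC subr0 mulr1 hornerXn exprVn.
Qed.

Lemma chi1_bound t : `|chi 1 t| <= 1 :> R.
Proof.
rewrite /chi; case: ifPn => t0; last by rewrite normr0.
by rewrite hornerC mul1r ger0_norm ?expR_ge0// expR_le1 oppr_le0 invr_ge0 ltW.
Qed.

Lemma chi1_near1 t : 0 < t -> `|1 - chi 1 t| <= t^-1 :> R.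
Proof.
move=> t0; rewrite /chi t0 hornerC mul1r ger0_norm.
  by have := expR_ge1Dx (- t^-1); lra.
by rewrite subr_ge0 expR_le1 oppr_le0 invr_ge0 ltW.
Qed.

(** With [t + 1 = n x (a - x)], this quantity is, up to constants, the product of
    the derivative of the cutoff and of the sine; a bound uniform in [t] is a bound
    uniform in [n]. *)
Lemma dchi_bound : exists K : R, forall t, `|dchi t| * `|t + 1| <= K.
Proof.
have [C C0 hC] := poly_expRN_bound ('X^2 * (1 - 1^`()) : {poly R}).
exists (2 * C + 2) => t.
have [t0|t0] := leP t 0.
  by rewrite /dchi /chi ltNge t0/= normr0 mul0r; lra.
rewrite [`|t + 1|]gtr0_norm; last lra.
have [t1|t1] := leP t 1.
  have : `|dchi t| <= C.
    have := hC t^-1; rewrite invf_ge1// => /(_ t1).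
    rewrite /dchi /chi t0 => /le_trans; apply.
    by rewrite -exprVn invrK ler_piMr// exprn_ile1// ltW.
  by have := normr_ge0 (dchi t); nra.
rewrite dchiE// ger0_norm; last by rewrite mulr_ge0 ?expR_ge0// invr_ge0 exprn_ge0 ?ltW.
have e1 : expR (- t^-1) <= 1 by rewrite expR_le1 oppr_le0 invr_ge0 ltW.
have e0 := expR_ge0 (- t^-1).
rewrite -mulrA mulrC ler_pdivrMr ?exprn_gt0//; nra.
Qed.

Lemma dchi_small t : 1 <= t -> `|dchi t| * `|t + 1| <= 2 * t^-1.
Proof.
move=> t1; have t0 : 0 < t by lra.
rewrite [`|t + 1|]gtr0_norm; last lra.
rewrite dchiE// ger0_norm; last by rewrite mulr_ge0 ?expR_ge0// invr_ge0 exprn_ge0 ?ltW.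
have e1 : expR (- t^-1) <= 1 by rewrite expR_le1 oppr_le0 invr_ge0 ltW.
have e0 := expR_ge0 (- t^-1).
rewrite -mulrA mulrC ler_pdivrMr ?exprn_gt0//.
rewrite expr2 mulrA -[2 * t^-1 * t]mulrA mulVf ?gt_eqF// mulr1; nra.
Qed.

Lemma near_natmul_ge (c B : R) : 0 < c -> \forall n \near \oo, B <= n.+1%:R * c - 1.
Proof.
move=> c0; near=> n.
have : (B + 1) / c <= n%:R by near: n; exact: nbhs_infty_ger.
rewrite ler_pdivrMr// -(natr1 n); nra.
Unshelve. all: by end_near.
Qed.

Variables (a : R) (k : nat).
Hypothesis a0 : 0 < a.

(** The cutoff [chi 1 (n x (a - x) - 1)] vanishes unless [x (a - x) > 1 / n], so
    that the support stays away from the ends, and tends to [1] inside since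
    [exp (- 1 / t)] tends to [1] at infinity. *)
Definition cutoff_sin (n : nat) (x : R) :=
  chi 1 (n.+1%:R * (x * (a - x)) - 1) * sin (freq a k * x).

Let dcut (n : nat) (x : R) :=
  chi 1 (n.+1%:R * (x * (a - x)) - 1) * (cos (freq a k * x) * freq a k) +
  sin (freq a k * x) *
    (dchi (n.+1%:R * (x * (a - x)) - 1) * (n.+1%:R * (a - 2 * x))).

Lemma smooth1_cutoff_sin n : smooth1 (cutoff_sin n).
Proof.
move=> m; apply: CnM; last first.
  rewrite (_ : (fun x => _) = sin \o (fun x => freq a k * x))//.
  by apply: Cn_comp; [exact: Cn_sin|apply: CnM; [exact: Cn_cst|exact: Cn_id]].
rewrite (_ : (fun x => _) = chi 1 \o (fun x => n.+1%:R * (x * (a + (-1) * x)) + (-1))).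
  apply: Cn_comp; first exact: Cn_chi.
  apply: CnD; last exact: Cn_cst.
  apply: CnM; first exact: Cn_cst.
  apply: CnM; first exact: Cn_id.
  apply: CnD; first exact: Cn_cst.
  by apply: CnM; [exact: Cn_cst|exact: Cn_id].
by apply/funext => x /=; rewrite mulN1r.
Qed.

Lemma is_derive_cutoff_sin n (x : R) : is_derive x (1:R) (cutoff_sin n) (dcut n x).
Proof.
have d1 : is_derive x (1:R) (fun x : R => freq a k * x) (freq a k).
  have := is_deriveZ (freq a k) (is_derive_id x (1:R)).
  by move=> h; apply: (is_derive_eq h); rewrite /GRing.scale /= mulr1.
have d2 := is_derive1_comp (g := fun x : R => freq a k * x) (x := x) (is_derive_sin _) d1.
have d3 : is_derive x (1:R) (fun x : R => n.+1%:R * (x * (a - x)) - 1) (n.+1%:R * (a - 2 * x)).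
  have e1 : is_derive x (1:R) (fun x : R => a - x) (0 - 1).
    exact: is_deriveB.
  have e2 := is_deriveM (is_derive_id x (1:R)) e1.
  have e3 := is_deriveB (is_deriveZ n.+1%:R e2) (is_derive_cst (1:R) x (1:R)).
  by apply: (is_derive_eq e3); rewrite /GRing.scale /=; ring.
have d4 := is_derive1_comp (g := fun x : R => n.+1%:R * (x * (a - x)) - 1) (x := x)
  (is_derive_chi 1 _) d3.
exact: is_deriveM d4 d2.
Qed.

Lemma derive1_cutoff_sin n : (cutoff_sin n)^`()%classic = dcut n.
Proof.
by apply/funext => x; rewrite derive1E; have := is_derive_cutoff_sin n x => -[].
Qed.

Lemma cutoff_sin_support n : exists2 c, 0 < c &
  forall x, cutoff_sin n x != 0 -> c <= x <= a - c.
Proof.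
exists (n.+1%:R^-1 / a); first by rewrite divr_gt0// invr_gt0.
move=> x; rewrite /cutoff_sin /chi; case: ifPn => [|_]; last by rewrite mul0r eqxx.
rewrite subr_gt0 => h _.
have h1 : n.+1%:R^-1 < x * (a - x).
  by rewrite -(ltr_pM2l (ltr0Sn R n)) mulfV.
have h2 : 0 < n.+1%:R^-1 :> R by rewrite invr_gt0.
have h3 : 0 < x * (a - x) by exact: lt_trans h1.
have x0 : 0 < x.
  rewrite ltNge; apply/negP => x0; move: h3; rewrite ltNge mulr_le0_ge0//.
  by rewrite subr_ge0 (le_trans x0)// ltW.
have xa : x < a by rewrite -subr_gt0 -(pmulr_rgt0 _ x0).
move: (n.+1%:R^-1) h1 h2 {h} => w h1 h2.
have c1 : w / a <= x by rewrite ler_pdivrMr//; nra.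
have c2 : w / a <= a - x by rewrite ler_pdivrMr//; nra.
by rewrite c1 /=; lra.
Qed.

Lemma cutoff_sin_bound n x : `|cutoff_sin n x| <= 1.
Proof.
by rewrite normrM -[leRHS]mulr1 ler_pM// ?chi1_bound// sin_max.
Qed.

(** Bounded pointwise convergence of the derivatives replaces an estimate of
    their [L^2] distance: dominated convergence then gives the convergence in
    [H^1]. *)
Lemma derive1_cutoff_sin_bound :
  exists M : R, forall n x, 0 < x < a -> `|(cutoff_sin n)^`()%classic x| <= M.
Proof.
have [K hK] := dchi_bound; have f0 := freq_gt0 k a0.
exists (freq a k + 2 * freq a k * K) => n x xa; rewrite derive1_cutoff_sin.
apply: (le_trans (ler_normD _ _)); apply: lerD.
  rewrite normrM -[leRHS]mul1r ler_pM// ?chi1_bound// normrM -[leRHS]mul1r.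
  by rewrite ler_pM// ?cos_max// gtr0_norm.
set t := n.+1%:R * (x * (a - x)) - 1.
have tE : n.+1%:R * (x * (a - x)) = t + 1 by rewrite /t subrK.
rewrite normrM; have h := sin_freq_bound k a0 xa.
apply: (le_trans (ler_wpM2r (normr_ge0 _) h)).
have ax : `|a - 2 * x| <= a by case/andP: xa => *; rewrite ler_norml; apply/andP; split; lra.
rewrite 2!normrM (ger0_norm (ler0n _ _)).
have -> : 2 * freq a k / a * (x * (a - x)) * (`|dchi t| * (n.+1%:R * `|a - 2 * x|)) =
  2 * freq a k / a * `|a - 2 * x| * (`|dchi t| * (n.+1%:R * (x * (a - x)))) by ring.
have q0 : 0 <= x * (a - x) by case/andP: xa => *; nra.
have t0 : 0 <= n.+1%:R * (x * (a - x)) by exact: mulr_ge0.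
rewrite tE in t0 *; rewrite ler_pM//.
- by rewrite mulr_ge0// divr_ge0 ?ltW// mulr_gt0.
- exact: mulr_ge0.
- rewrite -mulrA ler_piMr//; first by rewrite mulr_ge0// ltW.
  by rewrite ler_pdivrMl// mulr1.
- by have := hK t; rewrite (ger0_norm t0).
Qed.

Lemma cutoff_sin_cvg x : 0 < x < a ->
  cutoff_sin n x @[n --> \oo] --> sin (freq a k * x).
Proof.
move=> /andP[x0 xa]; have q0 : 0 < x * (a - x) by rewrite mulr_gt0// subr_gt0.
apply/cvgrPdist_le => e e0; near=> n.
have tn : e^-1 <= n.+1%:R * (x * (a - x)) - 1 by near: n; exact: near_natmul_ge.
have t0 : 0 < n.+1%:R * (x * (a - x)) - 1 by rewrite (lt_le_trans _ tn) ?invr_gt0.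
rewrite /cutoff_sin -{1}[sin _]mul1r -mulrBl normrM.
apply: (@le_trans _ _ (e * 1)); last by rewrite mulr1.
rewrite ler_pM// ?sin_max// (le_trans (chi1_near1 t0))//.
by rewrite -[e]invrK lef_pV2 ?posrE ?invr_gt0.
Unshelve. all: by end_near.
Qed.

Lemma derive1_cutoff_sin_cvg x : 0 < x < a ->
  (cutoff_sin n)^`()%classic x @[n --> \oo] --> freq a k * cos (freq a k * x).
Proof.
move=> xa; have f0 := freq_gt0 k a0.
have q0 : 0 < x * (a - x) by case/andP : xa => *; rewrite mulr_gt0// subr_gt0.
pose C := freq a k + 4 * freq a k; have C0 : 0 < C by rewrite /C; lra.
apply/cvgrPdist_le => e e0; near=> n; rewrite derive1_cutoff_sin.
have tn : (e / C)^-1 <= n.+1%:R * (x * (a - x)) - 1.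
  by near: n; exact: near_natmul_ge.
have t1 : 1 <= n.+1%:R * (x * (a - x)) - 1 by near: n; exact: near_natmul_ge.
set t := n.+1%:R * (x * (a - x)) - 1 in tn t1.
have t0 : 0 < t by lra.
have te : t^-1 <= e / C.
  by rewrite -[e / C]invrK lef_pV2 ?posrE ?invr_gt0// divr_gt0.
have tE : n.+1%:R * (x * (a - x)) = t + 1 by rewrite /t subrK.
rewrite /dcut -/t.
have -> : freq a k * cos (freq a k * x) -
  (chi 1 t * (cos (freq a k * x) * freq a k) +
   sin (freq a k * x) * (dchi t * (n.+1%:R * (a - 2 * x)))) =
  (1 - chi 1 t) * (cos (freq a k * x) * freq a k) -
  sin (freq a k * x) * (dchi t * (n.+1%:R * (a - 2 * x))) by ring.
apply: (le_trans (ler_normB _ _)).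
have -> : e = e / C * freq a k + e / C * (4 * freq a k).
  by rewrite -mulrDr -/C divfK// gt_eqF.
apply: lerD.
  rewrite normrM ler_pM// ?(le_trans (chi1_near1 t0))//.
  by rewrite normrM -[leRHS]mul1r ler_pM// ?cos_max// gtr0_norm.
rewrite normrM; have h := sin_freq_bound k a0 xa.
apply: (le_trans (ler_wpM2r (normr_ge0 _) h)).
have ax : `|a - 2 * x| <= a by case/andP: xa => *; rewrite ler_norml; apply/andP; split; lra.
rewrite 2!normrM (ger0_norm (ler0n _ _)).
have -> : 2 * freq a k / a * (x * (a - x)) * (`|dchi t| * (n.+1%:R * `|a - 2 * x|)) =
  (`|dchi t| * (n.+1%:R * (x * (a - x)))) * (2 * freq a k / a * `|a - 2 * x|) by ring.
rewrite tE; have := dchi_small t1; rewrite [`|t + 1|]gtr0_norm; last lra.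
move=> hh; apply: (@le_trans _ _ ((2 * t^-1) * (2 * freq a k))).
  apply: ler_pM => //.
  - by rewrite mulr_ge0//; lra.
  - by rewrite mulr_ge0// divr_ge0 ?ltW// mulr_gt0.
  - rewrite -mulrA ler_piMr//; first by rewrite mulr_ge0// ltW.
    by rewrite ler_pdivrMl// mulr1.
by nra.
Unshelve. all: by end_near.
Qed.

End cutoff.

(** * Product functions and integration by parts on a box *)

Section lines.
Context {R : realType} {N : nat}.
Implicit Types (f : 'rV[R]_N -> R) (x v : 'rV[R]_N).

(** Directional derivatives are ordinary derivatives along a line, which gives
    access to the chain rule and to the mean value theorem. *)
Lemma is_derive_line f x v (t l : R) :
  is_derive t (1 : R) (fun h : R => f (h *: v + x)) l <->
  is_derive (t *: v + x) v f l.
Proof.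
have E : (fun h : R => h^-1 *: (((fun h : R => f (h *: v + x)) \o shift t) (h *: (1 : R))
    - f (t *: v + x))) =
  (fun h => h^-1 *: ((f \o shift (t *: v + x)) (h *: v) - f (t *: v + x))).
  apply/funext => h /=; congr (_ *: (f _ - _)).
  by rewrite [h *: 1]mulr1 scalerDl addrA.
split=> -[h1 h2]; apply: DeriveDef.
- by rewrite /derivable -E.
- by rewrite /derive -E.
- by rewrite /derivable E.
- by rewrite /derive E.
Qed.

(** Functions with separated variables. They are the only explicit functions of
    several variables that occur, and are stable under partial derivatives
    ([partial_prodf]). *)
Definition prodf (g : 'I_N -> R -> R) : 'rV[R]_N -> R :=
  fun x => \prod_i g i (x 0 i).

Definition dprodf (i : 'I_N) (g : 'I_N -> R -> R) : 'I_N -> R -> R :=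
  fun j => if j == i then (g j)^`()%classic else g j.

Lemma is_derive_prodf g i x : (forall j, smooth1 (g j)) ->
  is_derive x (delta_mx 0 i) (prodf g) (prodf (dprodf i g) x).
Proof.
move=> sg; rewrite -[X in is_derive X](_ : (0:R) *: (delta_mx 0 i) + x = x); last first.
  by rewrite scale0r add0r.
apply/is_derive_line.
pose C := \prod_(j | j != i) g j (x 0 j).
have E h : prodf g (h *: delta_mx 0 i + x) = g i (h + x 0 i) * C.
  rewrite /prodf (bigD1 i)//= !mxE !eqxx mulr1; congr (_ * _).
  by apply: eq_bigr => j /negbTE ji; rewrite !mxE ji mulr0 add0r.
rewrite (_ : (fun h => _) = (fun h => g i (h + x 0 i) * C)); last exact/funext.
have -> : prodf (dprodf i g) x = (g i)^`()%classic (x 0 i) * C.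
  rewrite /prodf (bigD1 i)//= /dprodf eqxx; congr (_ * _).
  by apply: eq_bigr => j /negbTE ->.
have d1 : is_derive (0 + x 0 i) (1 : R) (g i) ((g i)^`()%classic (x 0 i)).
  by rewrite add0r derive1E; apply: derivableP; exact: smooth1_derivable.
have d2 : is_derive (0 : R) (1 : R) (fun h : R => h + x 0 i) (1 + 0) by exact: is_deriveD.
have d3 := is_derive1_comp (g := fun h : R => h + x 0 i) (x := 0) d1 d2.
have d4 := is_deriveM d3 (is_derive_cst C (0 : R) (1 : R)).
by apply: (is_derive_eq d4); rewrite /GRing.scale /=; ring.
Qed.

Lemma partial_prodf g i : (forall j, smooth1 (g j)) ->
  partial i (prodf g) = prodf (dprodf i g).
Proof.
by move=> sg; apply/funext => x; have := is_derive_prodf i x sg => -[].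
Qed.

Lemma smooth1_dprodf g i : (forall j, smooth1 (g j)) ->
  forall j, smooth1 (dprodf i g j).
Proof.
by move=> sg j; rewrite /dprodf; case: ifP => // _; exact: smooth1_derive1.
Qed.

Lemma continuous_prodf g : (forall j, continuous (g j)) -> continuous (prodf g).
Proof.
move=> cg; apply: continuous_big => [|i _]; first exact: mul_continuous.
move=> x; apply: (@continuous_comp _ _ _ (fun y : 'rV[R]_N => y 0 i) (g i)).
  exact: coord_continuous.
exact: cg.
Qed.

Lemma smooth_prodf g : (forall j, smooth1 (g j)) -> smooth (prodf g).
Proof.
move=> sg s.
have [g' [sg' ->]] : exists g', (forall j, smooth1 (g' j)) /\
    foldr partial (prodf g) s = prodf g'.
  elim: s => [|i s [g' [sg' E]]] /=; first by exists g.
  exists (dprodf i g'); split; first exact: smooth1_dprodf.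
  by rewrite E partial_prodf.
split; first by apply: continuous_prodf => j; exact: smooth1_continuous.
by move=> i x; have := is_derive_prodf i x sg' => -[].
Qed.

Lemma test_function_prodf (a : 'I_N -> R) (g : 'I_N -> R -> R) :
  (forall j, smooth1 (g j)) ->
  (forall j, exists2 c, 0 < c & forall y, g j y != 0 -> c <= y <= a j - c) ->
  test_function (rV_box a) (prodf g).
Proof.
move=> sg hg.
have /choice[c hc] : forall j, exists c, 0 < c /\ forall y, g j y != 0 -> c <= y <= a j - c.
  by move=> j; have [c c0 h] := hg j; exists c.
pose K := [set x : 'rV[R]_N | forall i, `[c i, a i - c i]%classic (x ord0 i)].
have cK : compact K.
  by apply: (@rV_compact R _ (fun i => `[c i, a i - c i]%classic)) => i; exact: segment_compact.
have sK : Defs.support (prodf g) `<=` K.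
  have clK : closed K by apply: compact_closed => //; exact: norm_hausdorff.
  rewrite [X in _ `<=` X](closure_id K).1//; apply: closure_subset => x /= gx i.
  rewrite /= in_itv /=; apply: (hc i).2; apply: contra_neq gx => gi0.
  by rewrite /prodf (bigD1 i)//= gi0 mul0r.
split; first exact: smooth_prodf.
- by apply: subclosed_compact cK sK; exact: closed_closure.
- move=> x /sK Kx i; have := Kx i; rewrite /= in_itv /= => /andP[h1 h2].
  have c0 := (hc i).1.
  by rewrite (lt_le_trans c0 h1) /= (le_lt_trans h2)// ltrBlDr ltrDl.
Qed.

End lines.

Section integration_by_parts.
Context {R : realType} {N : nat}.
Variable a : 'I_N -> R.
Hypothesis a0 : forall i, 0 < a i.
Local Notation mu := (@lebesgue_rV R N).
Local Notation Omega := (rV_box a).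

Lemma rV_box_finite : (mu Omega < +oo)%E.
Proof. by rewrite lebesgue_rV_box ?ltry// => i; exact: ltW. Qed.

Lemma Rintegral_rV_shift (f : 'rV[R]_N -> R) (v : 'rV[R]_N) :
  measurable_fun setT f -> mu.-integrable setT (EFin \o f) ->
  mu.-integrable setT (EFin \o (fun x : 'rV[R]_N => f (x + v))) /\
  \int[mu]_x f (x + v) = \int[mu]_x f x.
Proof.
move=> mf fi.
have ms := measurable_rV_shift v.
pose nu := measure_function_pushforward__canonical__measure_function_Measure mu ms.
have munu A : measurable A -> nu A = mu A by exact: lebesgue_rV_shift.
have mfs : measurable_fun setT (fun x : 'rV[R]_N => f (x + v)).
  by apply: (measurableT_comp mf).
have ifs : mu.-integrable setT (EFin \o (fun x : 'rV[R]_N => f (x + v))).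
  apply/integrableP; split; first exact/measurable_EFinP.
  have /integrableP[_] := fi.
  rewrite (@eq_measure_integral _ _ _ _ nu mu); last by move=> A mA _; exact/esym/munu.
  rewrite ge0_integral_pushforward//.
  by apply: measurableT_comp => //; exact/measurable_EFinP.
split=> //; congr fine.
rewrite [RHS](@eq_measure_integral _ _ _ _ nu mu); last by move=> A mA _; exact/esym/munu.
rewrite [RHS]integral_pushforward//.
exact/measurable_EFinP.
Qed.

Lemma bounded_of_compact_support (g : 'rV[R]_N -> R) (K : set 'rV[R]_N) :
  continuous g -> compact K -> (forall x, ~ K x -> g x = 0) ->
  exists M : R, forall x, `|g x| <= M.
Proof.
move=> cg cK g0.
have cgK : compact (g @` K).
  by apply: continuous_compact => //; exact: continuous_subspaceT.
have [M [_ hM]] := compact_bounded cgK.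
exists (`|M| + 1) => x; have M1 : M < `|M| + 1 by have := ler_norm M; lra.
have [Kx|/g0 ->] := pselect (K x); last by rewrite normr0; have := normr_ge0 M; lra.
by apply: (hM _ M1); exists x.
Qed.

Lemma partial_out_support (F : 'rV[R]_N -> R) i x :
  ~ Defs.support F x -> partial i F x = 0.
Proof.
move=> Fx; have oC : open (~` Defs.support F) by apply: closed_openC; exact: closed_closure.
rewrite /partial -(@near_eq_derive _ _ _ (cst 0)); first exact: derive_cst.
have : nbhs x (~` Defs.support F) by apply: open_nbhs_nbhs.
apply: filterS => y Fy /=; apply/esym/eqP; apply: contra_notT Fy => Fy.
exact: subset_closure.
Qed.

(** The difference quotients of [F] in direction [i] have zero integral by
    translation invariance, and converge boundedly to the partial derivative by the
    mean value theorem. All of them vanish outside one larger box [D], of finite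
    measure, where dominated convergence applies. *)
Lemma Rintegral_partial_eq0 (F : 'rV[R]_N -> R) i :
  continuous F -> (forall x, derivable F x (delta_mx 0 i)) ->
  continuous (partial i F) ->
  compact (Defs.support F) -> Defs.support F `<=` Omega ->
  \int[mu]_(x in Omega) partial i F x = 0.
Proof.
move=> cF dF cdF cK KO.
have FO x : ~ Omega x -> F x = 0.
  move=> Ox; apply/eqP; apply: contra_notT Ox => Fx; apply: KO.
  exact: subset_closure.
have dFO x : ~ Omega x -> partial i F x = 0.
  by move=> Ox; apply: partial_out_support => /KO.
have [M hM] : exists M : R, forall x, `|partial i F x| <= M.
  by apply: (bounded_of_compact_support cdF cK) => x; exact: partial_out_support.
have [M' hM'] : exists M : R, forall x, `|F x| <= M.
  apply: (bounded_of_compact_support cF cK) => x Fx; apply/eqP.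
  by apply: contra_notT Fx => Fx; exact: subset_closure.
pose e := delta_mx 0 i : 'rV[R]_N.
pose h n : R := n.+1%:R^-1.
have h0 n : 0 < h n by rewrite invr_gt0.
have h1 n : h n <= 1 by rewrite invf_le1// ler1n.
pose Q n x := (F (x + h n *: e) - F x) / h n.
have lineE t x : is_derive t (1 : R) (fun s : R => F (s *: e + x)) (partial i F (t *: e + x)).
  by apply/is_derive_line; apply: derivableP; exact: dF.
have QM n x : `|Q n x| <= M.
  rewrite normrM [`|_^-1|]gtr0_norm ?invr_gt0// ler_pdivrMr//.
  have [|c _] := @MVT_segment R (fun s : R => F (s *: e + x)) (fun t => partial i F (t *: e + x))
      0 (h n) (ltW (h0 n)) (fun t _ => lineE t x).
    apply: continuous_subspaceT; apply: is_derive_continuous => t; exact: lineE.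
  rewrite scale0r add0r subr0 [x + _]addrC => ->.
  by rewrite normrM (gtr0_norm (h0 n)) ler_pM2r.
have Qcvg x : Q n x @[n --> \oo] --> partial i F x.
  have := lineE 0 x; rewrite scale0r add0r => -[dd <-].
  have hcvg : h n @[n --> \oo] --> (0 : R)^'.
    move=> A /= A0; have A0' := @cvg_harmonic R _ A0.
    have A0n : \forall n \near \oo, h n != 0 -> A (h n) := A0'.
    change (\forall n \near \oo, A (h n)); apply: filterS A0n => n; apply.
    by rewrite gt_eqF.
  have := cvg_comp _ _ hcvg dd.
  set q := (_ \o h); suff -> : (fun n => Q n x) = q by [].
  apply/funext => n; rewrite /q /Q /=.
  rewrite [h n *: 1]mulr1 addr0 scale0r add0r /GRing.scale /= mulrC.
  by rewrite [x + _]addrC.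
(* the box with sides enlarged by [1] in each direction, which contains the
   supports of the translates by at most [1] *)
pose D := (fun x : 'rV[R]_N => x + const_mx 1) @^-1` rV_box (fun j => a j + 2).
have mD : measurable D.
  by rewrite -[D]setTI; apply: measurable_rV_shift => //; exact: rV_box_measurable.
have finD : (mu D < +oo)%E.
  rewrite lebesgue_rV_shift; last exact: rV_box_measurable.
  by rewrite lebesgue_rV_box ?ltry// => j; have := a0 j; lra.
have DE x : D x <-> forall j, -1 < x 0 j < a j + 1.
  by split=> H j; have := H j; rewrite !mxE => /andP[? ?]; apply/andP; split; lra.
have OD : Omega `<=` D.
  by move=> x Ox; apply/DE => j; have /andP[? ?] := Ox j; apply/andP; split; lra.
have QD n x : ~ D x -> F (x + h n *: e) = 0.
  move=> Dx; apply: FO => Ox; apply: Dx; apply/DE => j.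
  have := Ox j; rewrite !mxE eqxx /=; have := h0 n; have := h1 n.
  by case: (j == i); rewrite ?mulr1 ?mulr0 => ? ? /andP[? ?]; apply/andP; split; lra.
have mF : measurable_fun setT F by exact: rV_continuous_measurable.
have restr (E : set 'rV[R]_N) (f : 'rV[R]_N -> R) : (forall x, ~ E x -> f x = 0) ->
    \int[mu]_x f x = \int[mu]_(x in E) f x.
  move=> f0; rewrite [RHS]Rintegral_mkcond; apply: eq_Rintegral => x _.
  by rewrite patchE; case: ifPn => // /negP; rewrite inE => /f0.
have FD x : ~ D x -> F x = 0 by move=> Dx; apply: FO => /OD.
have iFD : mu.-integrable D (EFin \o F).
  apply: (bounded_mfun_integrable mD finD); split; first exact: measurable_funTS.
  by exists M' => x _.
have iF : mu.-integrable setT (EFin \o F).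
  move: (iFD) => /(integrable_mkcond _ mD).
  rewrite (_ : _ \_ D = EFin \o F)//; apply/funext => x.
  by rewrite patchE; case: ifPn => // /negP; rewrite inE /= => /FD ->.
have Q0 n : \int[mu]_(x in D) Q n x = 0.
  have [iFs EFs] := Rintegral_rV_shift (h n *: e) mF iF.
  have iFsD : mu.-integrable D (EFin \o (fun x : 'rV[R]_N => F (x + h n *: e))).
    exact: (integrableS measurableT).
  have iB : mu.-integrable D (EFin \o (fun x : 'rV[R]_N => F (x + h n *: e) - F x)).
    exact: (integrableB mD iFsD iFD).
  rewrite RintegralZr//.
  rewrite RintegralB// -(restr D)//; last exact: QD.
  by rewrite EFs -(restr D)// subrr mul0r.
have mQ n : measurable_fun D (Q n).
  apply: measurable_funM => //; apply: measurable_funB; last exact: measurable_funTS.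
  by apply: measurable_funTS; apply: (measurableT_comp mF); exact: measurable_rV_shift.
have i1 := bounded_mfun_integrable mD finD (bounded_mfun_cst D (1 : R)).
have := Rintegral_bounded_cvg mD i1 mQ (fun n x _ => QM n x) (fun x _ => Qcvg x).
under eq_fun => n do under eq_Rintegral do rewrite mul1r.
under eq_Rintegral do rewrite mul1r.
rewrite (_ : (fun n => _) = fun=> 0); last exact/funext.
rewrite -(restr D); last by move=> x Dx; apply: dFO => /OD.
rewrite -(restr Omega)// => H.
exact: (cvg_unique _ H (cvg_cst _)).
Qed.

Lemma bounded_mfun_continuous (g : 'rV[R]_N -> R) : continuous g -> bounded_mfun Omega g.
Proof.
move=> cg; split; first by apply: measurable_funTS; exact: rV_continuous_measurable.
pose K := [set x : 'rV[R]_N | forall i, `[0, a i]%classic (x ord0 i)].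
have cK : compact K.
  by apply: (@rV_compact R _ (fun i => `[0, a i]%classic)) => i; exact: segment_compact.
have cgK : compact (g @` K).
  by apply: continuous_compact => //; exact: continuous_subspaceT.
have [M [_ hM]] := compact_bounded cgK.
exists (`|M| + 1) => x Ox; have M1 : M < `|M| + 1 by have := ler_norm M; lra.
apply: (hM _ M1); exists x => // i.
by rewrite /= in_itv /=; have /andP[/ltW-> /ltW->] := Ox i.
Qed.

Lemma integration_by_parts_rV g i phi : (forall j, smooth1 (g j)) ->
  test_function Omega phi ->
  \int[mu]_(x in Omega) (prodf g x * partial i phi x) =
  - \int[mu]_(x in Omega) (prodf (dprodf i g) x * phi x).
Proof.
move=> sg [sphi cphi phiO].
have [cont_phi der_phi] := sphi [::].
have [cont_dphi _] := sphi [:: i].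
have sdg := smooth1_dprodf i sg.
have cg : continuous (prodf g) by apply: continuous_prodf => j; exact: smooth1_continuous.
have cdg : continuous (prodf (dprodf i g)).
  by apply: continuous_prodf => j; exact: smooth1_continuous.
pose F (x : 'rV[R]_N) := prodf g x * phi x.
have dF (x : 'rV[R]_N) : is_derive x (delta_mx 0 i) F
    (prodf g x * partial i phi x + prodf (dprodf i g) x * phi x).
  have := is_deriveM (is_derive_prodf i x sg) (derivableP (der_phi i x)).
  by move=> H; apply: (is_derive_eq H); rewrite /GRing.scale /= [phi x * _]mulrC.
have EF : partial i F = fun x => prodf g x * partial i phi x + prodf (dprodf i g) x * phi x.
  by apply/funext => x; have := dF x => -[].
have SF : Defs.support F `<=` Defs.support phi.
  by apply: closure_subset => x; rewrite /= /F; apply: contra_neq => ->; rewrite mulr0.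
have mO : measurable Omega by exact: rV_box_measurable.
have : \int[mu]_(x in Omega) partial i F x = 0.
  apply: Rintegral_partial_eq0.
  - by move=> x; exact: (cvgM (cg x) (cont_phi x)).
  - by move=> x; have := dF x => -[].
  - rewrite EF => x.
    exact: (cvgD (cvgM (cg x) (cont_dphi x)) (cvgM (cdg x) (cont_phi x))).
  - by apply: subclosed_compact cphi SF; exact: closed_closure.
  - exact: subset_trans phiO.
rewrite EF RintegralD//; first by move/eqP; rewrite addr_eq0 => /eqP.
- apply: (bounded_mfun_integrable mO rV_box_finite); apply: bounded_mfunM;
    exact: bounded_mfun_continuous.
- apply: (bounded_mfun_integrable mO rV_box_finite); apply: bounded_mfunM;
    exact: bounded_mfun_continuous.
Qed.
End integration_by_parts.

(** * The sine products are orthogonal eigenfunctions *)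

Section sine_products.
Context {R : realType} {N : nat}.
Variable a : 'I_N -> R.
Hypothesis a0 : forall i, 0 < a i.
Local Notation mu := (@lebesgue_rV R N).
Local Notation Omega := (rV_box a).
Implicit Types kk : {ffun 'I_N -> nat}.

Definition sin_factor kk (i : 'I_N) (y : R) : R := sin (freq (a i) (kk i) * y).

Definition sin_prod kk : 'rV[R]_N -> R := prodf (sin_factor kk).

Definition box_energy kk : R := \sum_i freq (a i) (kk i) ^+ 2.

Let mO : measurable Omega. Proof. exact: rV_box_measurable. Qed.
Let finO : (mu Omega < +oo)%E. Proof. exact: rV_box_finite. Qed.

Lemma is_derive_sin_factor kk i (y : R) :
  is_derive y (1 : R) (sin_factor kk i) (cos (freq (a i) (kk i) * y) * freq (a i) (kk i)).
Proof.
have d1 : is_derive y (1:R) (fun y : R => freq (a i) (kk i) * y) (freq (a i) (kk i)).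
  have h := is_deriveZ (freq (a i) (kk i)) (is_derive_id y (1:R)).
  by apply: (is_derive_eq h); rewrite /GRing.scale /= mulr1.
exact: (is_derive1_comp (g := fun y : R => freq (a i) (kk i) * y) (x := y) (is_derive_sin _) d1).
Qed.

Lemma derive1_sin_factor kk i :
  (sin_factor kk i)^`()%classic = fun y => freq (a i) (kk i) * cos (freq (a i) (kk i) * y).
Proof.
by apply/funext => y; rewrite derive1E mulrC; have := is_derive_sin_factor kk i y => -[].
Qed.

Lemma smooth1_sin_factor kk i : smooth1 (sin_factor kk i).
Proof.
move=> n; rewrite (_ : sin_factor _ _ = sin \o (fun x => freq (a i) (kk i) * x))//.
by apply: Cn_comp; [exact: Cn_sin|apply: CnM; [exact: Cn_cst|exact: Cn_id]].
Qed.

Lemma dprodf2_sin_factor kk i x :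
  prodf (dprodf i (dprodf i (sin_factor kk))) x = - (freq (a i) (kk i) ^+ 2) * sin_prod kk x.
Proof.
rewrite /sin_prod /prodf (bigD1 i)//= [in RHS](bigD1 i)//= mulrA; congr (_ * _).
  rewrite /dprodf eqxx derive1_sin_factor derive1E.
  have d1 : is_derive (x 0 i) (1:R) (fun y : R => freq (a i) (kk i) * y) (freq (a i) (kk i)).
    have h := is_deriveZ (freq (a i) (kk i)) (is_derive_id (x 0 i) (1:R)).
    by apply: (is_derive_eq h); rewrite /GRing.scale /= mulr1.
  have d2 := is_derive1_comp (g := fun y : R => freq (a i) (kk i) * y)
    (x := x 0 i) (is_derive_cos _) d1.
  have := is_deriveZ (freq (a i) (kk i)) d2 => -[_ ->].
  by rewrite /GRing.scale /= /sin_factor; ring.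
by apply: eq_bigr => j /negbTE ji; rewrite /dprodf ji.
Qed.

Lemma prodf_bound (g : 'I_N -> R -> R) (M : R) (x : 'rV[R]_N) : 0 <= M ->
  (forall j, `|g j (x 0 j)| <= M) -> `|prodf g x| <= M ^+ N.
Proof.
move=> M0 gM; rewrite /prodf normr_prod.
rewrite (_ : M ^+ N = \prod_(j < N) M); last by rewrite prodr_const card_ord.
by apply: ler_prod => j _; rewrite gM normr_ge0.
Qed.

Lemma continuous_prodf_smooth (g : 'I_N -> R -> R) :
  (forall j, smooth1 (g j)) -> continuous (prodf g).
Proof. by move=> sg; apply: continuous_prodf => j; exact: smooth1_continuous. Qed.

Lemma bounded_mfun_prodf g : (forall j, smooth1 (g j)) -> bounded_mfun Omega (prodf g).
Proof. by move=> sg; apply: bounded_mfun_continuous => //; exact: continuous_prodf_smooth. Qed.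

Definition cut kk n (i : 'I_N) := cutoff_sin (a i) (kk i) n.

Lemma smooth1_cut kk n i : smooth1 (cut kk n i).
Proof. exact: smooth1_cutoff_sin. Qed.

Lemma test_function_cut kk n : test_function Omega (prodf (cut kk n)).
Proof.
by apply: test_function_prodf => j; [exact: smooth1_cut|exact: cutoff_sin_support].
Qed.

Lemma cut_cvg kk x : Omega x -> prodf (cut kk n) x @[n --> \oo] --> sin_prod kk x.
Proof.
move=> Ox; apply: cvg_big => [|i _]; first exact: mul_continuous.
exact: cutoff_sin_cvg.
Qed.

Lemma dcut_cvg kk i x : Omega x ->
  prodf (dprodf i (cut kk n)) x @[n --> \oo] --> prodf (dprodf i (sin_factor kk)) x.
Proof.
move=> Ox; apply: cvg_big => [|j _]; first exact: mul_continuous.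
rewrite /dprodf; case: eqP => [->|_]; last exact: cutoff_sin_cvg.
by rewrite derive1_sin_factor; exact: derive1_cutoff_sin_cvg.
Qed.

Lemma cut_bound kk n x : `|prodf (cut kk n) x| <= 1.
Proof.
rewrite -[leRHS](expr1n R N); apply: prodf_bound => // j; exact: cutoff_sin_bound.
Qed.

Lemma dcut_bound kk i : exists M : R, forall n x, Omega x -> `|prodf (dprodf i (cut kk n)) x| <= M.
Proof.
have [M hM] := derive1_cutoff_sin_bound (kk i) (a0 i).
pose M1 := `|M| + 1; have M10 : 0 <= `|M| by [].
exists (M1 ^+ N) => n x Ox; apply: prodf_bound => [|j]; first by rewrite /M1; lra.
rewrite /dprodf /M1; case: eqP => [->|_].
  by have := hM n (x 0 i) (Ox i); have := ler_norm M; rewrite /cut; lra.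
by rewrite (le_trans (cutoff_sin_bound _ _ _ _))// lerDr.
Qed.

Lemma measurable_prodf g : (forall j, smooth1 (g j)) -> measurable_fun Omega (prodf g).
Proof. by move=> /bounded_mfun_prodf[]. Qed.

(** The cutoff sines are test functions whose products, and first derivatives of
    products, converge boundedly on the box. *)
Lemma H10_sin_prod kk :
  H10 Omega (sin_prod kk) (fun i => prodf (dprodf i (sin_factor kk))).
Proof.
have sf := smooth1_sin_factor kk.
have sdf i := smooth1_dprodf i sf.
split.
- exact: (square_integrable_bounded mO finO (bounded_mfun_prodf sf)).
- by move=> i; exact: (square_integrable_bounded mO finO (bounded_mfun_prodf (sdf i))).
- exists (fun n => prodf (cut kk n)); split.
  + by move=> n; exact: test_function_cut.
  + have [mf [M hM]] := bounded_mfun_prodf sf.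
    apply: (L2_bounded_cvg mO finO (M := 1 + M)) => //.
    * by move=> n; exact: (measurable_prodf (smooth1_cut kk n)).
    * by move=> n x Ox; rewrite (le_trans (ler_normB _ _))// lerD ?cut_bound// hM.
    * by move=> x Ox; exact: cut_cvg.
  + move=> i; have [mf [M hM]] := bounded_mfun_prodf (sdf i).
    have [M' hM'] := dcut_bound kk i.
    have E n : partial i (prodf (cut kk n)) = prodf (dprodf i (cut kk n)).
      by rewrite partial_prodf// => j; exact: smooth1_cut.
    under eq_fun do rewrite E.
    apply: (L2_bounded_cvg mO finO (M := M' + M)) => //.
    * by move=> n; exact: (measurable_prodf (smooth1_dprodf i (smooth1_cut kk n))).
    * by move=> n x Ox; rewrite (le_trans (ler_normB _ _))// lerD ?hM' ?hM.
    * by move=> x Ox; exact: dcut_cvg.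
Qed.

Lemma test_function_bounded phi : test_function Omega phi ->
  bounded_mfun Omega phi /\ forall i, bounded_mfun Omega (partial i phi).
Proof.
move=> [sphi _ _]; split.
  by apply: bounded_mfun_continuous; exact: (sphi [::]).1.
by move=> i; apply: bounded_mfun_continuous; exact: (sphi [:: i]).1.
Qed.

(** The weak form of the equation in the single direction [i]. It is kept separate
    because orthogonality of two modes uses a direction where they differ. *)
Lemma grad_sin_prod_test kk i phi : test_function Omega phi ->
  \int[mu]_(x in Omega) (prodf (dprodf i (sin_factor kk)) x * partial i phi x) =
  freq (a i) (kk i) ^+ 2 * \int[mu]_(x in Omega) (sin_prod kk x * phi x).
Proof.
move=> tphi; have [bphi bdphi] := test_function_bounded tphi.
have sf := smooth1_sin_factor kk; have sdf := smooth1_dprodf i sf.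
rewrite integration_by_parts_rV//.
under eq_Rintegral do rewrite dprodf2_sin_factor -mulrA.
rewrite RintegralZl//; first by rewrite mulNr opprK.
exact: (bounded_mfun_integrable mO finO (bounded_mfunM (bounded_mfun_prodf sf) bphi)).
Qed.

Lemma Rintegral_sum (I : Type) (r : seq I) (f : I -> 'rV[R]_N -> R) :
  (forall i, mu.-integrable Omega (EFin \o f i)) ->
  \int[mu]_(x in Omega) (\sum_(i <- r) f i x) = \sum_(i <- r) \int[mu]_(x in Omega) f i x.
Proof.
move=> fi; rewrite /Rintegral.
under eq_integral do rewrite -sumEFin.
rewrite integral_sum// sum_fine// => i _.
exact: (integrable_fin_num mO (fi i)).
Qed.

Lemma RintegralC (f g : 'rV[R]_N -> R) :
  \int[mu]_(x in Omega) (f x * g x) = \int[mu]_(x in Omega) (g x * f x).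
Proof. by apply: eq_Rintegral => x _; rewrite mulrC. Qed.

Lemma sin_prod_eigenfunction kk :
  dirichlet_eigenfunction Omega (box_energy kk) (sin_prod kk).
Proof.
exists (fun i => prodf (dprodf i (sin_factor kk))); first exact: H10_sin_prod.
move=> phi tphi; have [bphi bdphi] := test_function_bounded tphi.
have sf := smooth1_sin_factor kk.
rewrite Rintegral_sum; last first.
  move=> i; apply: (bounded_mfun_integrable mO finO); apply: bounded_mfunM => //.
  exact: bounded_mfun_prodf (smooth1_dprodf i sf).
under eq_bigr do rewrite grad_sin_prod_test//.
by rewrite -mulr_suml.
Qed.

(** Symmetry of the Dirichlet form between [u] and the sine product. Neither is
    compactly supported, so each side passes to the limit separately: [u] is
    approximated by test functions to move the derivatives onto the sine product,
    and the sine product by cutoff sines to use the equation of [u]. *)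
Lemma eigenfunction_sin_prod mu_ u kk : dirichlet_eigenfunction Omega mu_ u ->
  box_energy kk * \int[mu]_(x in Omega) (u x * sin_prod kk x) =
  mu_ * \int[mu]_(x in Omega) (u x * sin_prod kk x).
Proof.
move=> [G [L2u L2G [phi [tphi phiu phiG]]] weak].
have sf := smooth1_sin_factor kk.
have iu := square_integrable_integrable mO finO L2u.
have iG i := square_integrable_integrable mO finO (L2G i).
have bsf := bounded_mfun_prodf sf.
have bdf i := bounded_mfun_prodf (smooth1_dprodf i sf).
have H1 i : \int[mu]_(x in Omega) (G i x * prodf (dprodf i (sin_factor kk)) x) =
    freq (a i) (kk i) ^+ 2 * \int[mu]_(x in Omega) (u x * sin_prod kk x).
  have c1 := Rintegral_L2_cvg mO finO
    (fun n => square_integrable_bounded mO finO ((test_function_bounded (tphi n)).2 i))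
    (L2G i) (bdf i) (phiG i).
  have c2 := Rintegral_L2_cvg mO finO
    (fun n => square_integrable_bounded mO finO (test_function_bounded (tphi n)).1)
    L2u bsf phiu.
  have c3 : freq (a i) (kk i) ^+ 2 * \int[mu]_(x in Omega) (phi n x * sin_prod kk x)
      @[n --> \oo] --> freq (a i) (kk i) ^+ 2 * \int[mu]_(x in Omega) (u x * sin_prod kk x).
    by apply: cvgMl_tmp; exact: c2.
  have E n : freq (a i) (kk i) ^+ 2 * \int[mu]_(x in Omega) (phi n x * sin_prod kk x) =
      \int[mu]_(x in Omega) (partial i (phi n) x * prodf (dprodf i (sin_factor kk)) x).
    by rewrite [RHS]RintegralC grad_sin_prod_test// [in RHS]RintegralC.
  by move: c3; rewrite (eq_cvg _ _ E); exact: (cvg_unique _ c1).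
have weak_cut n : \sum_i \int[mu]_(x in Omega) (G i x * prodf (dprodf i (cut kk n)) x) =
    mu_ * \int[mu]_(x in Omega) (u x * prodf (cut kk n) x).
  rewrite -weak; last exact: test_function_cut.
  have E i : partial i (prodf (cut kk n)) = prodf (dprodf i (cut kk n)).
    by rewrite partial_prodf// => j; exact: smooth1_cut.
  under [RHS]eq_Rintegral do under eq_bigr do rewrite E.
  rewrite Rintegral_sum// => i; apply: integrableM_bounded => //.
  exact: bounded_mfun_prodf (smooth1_dprodf i (smooth1_cut kk n)).
have H2 : \sum_i \int[mu]_(x in Omega) (G i x * prodf (dprodf i (sin_factor kk)) x) =
    mu_ * \int[mu]_(x in Omega) (u x * sin_prod kk x).
  have c1 : \sum_i \int[mu]_(x in Omega) (G i x * prodf (dprodf i (cut kk n)) x)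
     @[n --> \oo] --> \sum_i \int[mu]_(x in Omega) (G i x * prodf (dprodf i (sin_factor kk)) x).
    apply: cvg_big => [|i _]; first exact: add_continuous.
    have [M hM] := dcut_bound kk i.
    apply: (Rintegral_bounded_cvg mO (iG i) _ hM) => [n|x Ox]; last exact: dcut_cvg.
    exact: (measurable_prodf (smooth1_dprodf i (smooth1_cut kk n))).
  have c2 : \int[mu]_(x in Omega) (u x * prodf (cut kk n) x) @[n --> \oo] -->
      \int[mu]_(x in Omega) (u x * sin_prod kk x).
    apply: (Rintegral_bounded_cvg mO iu _ (fun n x _ => cut_bound kk n x)) => [n|x Ox].
      exact: (measurable_prodf (smooth1_cut kk n)).
    exact: cut_cvg.
  have c3 : mu_ * \int[mu]_(x in Omega) (u x * prodf (cut kk n) x) @[n --> \oo] -->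
      mu_ * \int[mu]_(x in Omega) (u x * sin_prod kk x) by apply: cvgMl_tmp; exact: c2.
  by move: c3; rewrite -(eq_cvg _ _ weak_cut); exact: (cvg_unique _ c1).
by rewrite -H2 mulr_suml; apply: eq_bigr => i _; rewrite H1.
Qed.

Lemma sin_prod_orthogonal kk kk' : kk != kk' ->
  \int[mu]_(x in Omega) (sin_prod kk x * sin_prod kk' x) = 0.
Proof.
move=> kkk.
have [i ki] : exists i, kk i != kk' i.
  apply/existsP; rewrite -negb_forall; apply: contra kkk => /forallP h.
  by apply/eqP/ffunP => i; exact/eqP.
(* pairing the derivatives in direction [i] is symmetric in [kk], [kk'] *)
have H k1 k2 : \int[mu]_(x in Omega)
    (prodf (dprodf i (sin_factor k1)) x * prodf (dprodf i (sin_factor k2)) x)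
  = freq (a i) (k1 i) ^+ 2 * \int[mu]_(x in Omega) (sin_prod k1 x * sin_prod k2 x).
  have s1 := smooth1_sin_factor k1; have s2 := smooth1_sin_factor k2.
  have b1 := bounded_mfun_integrable mO finO (bounded_mfun_prodf s1).
  have b2 := bounded_mfun_integrable mO finO (bounded_mfun_prodf (smooth1_dprodf i s1)).
  have [M hM] := dcut_bound k2 i.
  have c1 := Rintegral_bounded_cvg mO b2
     (fun n => measurable_prodf (smooth1_dprodf i (smooth1_cut k2 n))) hM (@dcut_cvg k2 i).
  have c2 := Rintegral_bounded_cvg mO b1
     (fun n => measurable_prodf (smooth1_cut k2 n)) (fun n x _ => cut_bound k2 n x) (@cut_cvg k2).
  have c3 : freq (a i) (k1 i) ^+ 2 * \int[mu]_(x in Omega) (sin_prod k1 x * prodf (cut k2 n) x)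
      @[n --> \oo] -->
      freq (a i) (k1 i) ^+ 2 * \int[mu]_(x in Omega) (sin_prod k1 x * sin_prod k2 x).
    by apply: cvgMl_tmp; exact: c2.
  have E n : freq (a i) (k1 i) ^+ 2 * \int[mu]_(x in Omega) (sin_prod k1 x * prodf (cut k2 n) x) =
      \int[mu]_(x in Omega) (prodf (dprodf i (sin_factor k1)) x * prodf (dprodf i (cut k2 n)) x).
    rewrite -grad_sin_prod_test//; last exact: test_function_cut.
    by rewrite partial_prodf// => j; exact: smooth1_cut.
  by move: c3; rewrite (eq_cvg _ _ E); exact: (cvg_unique _ c1).
have := H kk kk'; rewrite RintegralC H RintegralC.
move/eqP; rewrite -subr_eq0 -mulrBl mulf_eq0 => /orP[|/eqP//].
rewrite subr_eq0 eqrXn2// ?ltW ?freq_gt0// => /eqP.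
rewrite /freq => /mulIf; rewrite invr_eq0 gt_eqF// => /(_ isT) /mulIf.
rewrite gt_eqF ?pi_gt0// => /(_ isT)/eqP; rewrite eqr_nat eqSS => /eqP kE.
by rewrite kE eqxx in ki.
Qed.

(** The square of the sine product is positive on the nodal cell at the origin,
    whose sides are the [a i / (kk i + 1)] and whose measure is positive. *)
Lemma sin_prod_norm_gt0 kk : 0 < \int[mu]_(x in Omega) (sin_prod kk x * sin_prod kk x).
Proof.
have sf := smooth1_sin_factor kk; have bf := bounded_mfun_prodf sf.
have i2 := bounded_mfun_integrable mO finO (bounded_mfunM bf bf).
rewrite lt_neqAle Rintegral_ge0 ?andbT; last first.
  by move=> x _; rewrite -expr2 sqr_ge0.
apply/negP => /eqP/esym I0.
(* the sides of the nodal cell at the origin *)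
pose b i : R := a i / (kk i).+1%:R.
have b0 i : 0 < b i by rewrite divr_gt0.
have bO : rV_box b `<=` Omega.
  move=> x bx i; have /andP[-> xb] := bx i; apply: (lt_le_trans xb).
  by rewrite ler_pdivrMr// ler_peMr ?ler1n// ltW.
have spos x : rV_box b x -> 0 < sin_prod kk x * sin_prod kk x.
  move=> bx; suff : 0 < sin_prod kk x by move=> ?; rewrite mulr_gt0.
  apply: prodr_gt0 => i _; apply: sin_gt0_pi; have /andP[x0 xb] := bx i.
  rewrite mulr_gt0 ?freq_gt0//= /freq.
  have E : (kk i).+1%:R * pi / a i * b i = pi :> R.
    have k0 : (kk i).+1%:R != 0 :> R by [].
    by rewrite /b; move: (_.+1%:R) k0 => m m0; field; rewrite m0 gt_eqF.
  by rewrite -[ltRHS]E ltr_pM2l//; exact: freq_gt0.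
have fE : (\int[mu]_(x in Omega) `|(sin_prod kk x * sin_prod kk x)%:E| = 0)%E.
  have -> : (\int[mu]_(x in Omega) `|(sin_prod kk x * sin_prod kk x)%:E| =
      \int[mu]_(x in Omega) (sin_prod kk x * sin_prod kk x)%:E)%E.
    by apply: eq_integral => x _; rewrite gee0_abs// lee_fin -expr2 sqr_ge0.
  rewrite -(fineK (integrable_fin_num mO i2)); congr EFin; exact: I0.
have /(ae_eq_integral_abs mu mO) :
  measurable_fun Omega (fun x => (sin_prod kk x * sin_prod kk x)%:E).
  exact: measurable_int i2.
move=> [/(_ fE) [Z [mZ Z0 ZO]] _].
have bZ : rV_box b `<=` Z.
  by move=> x bx; apply: ZO => /= /(_ (bO x bx)) [] h; have := spos x bx; rewrite h ltxx.
have : (mu (rV_box b) <= mu Z)%E.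
  by apply: le_measure => //; rewrite inE//; exact: rV_box_measurable.
rewrite Z0 lebesgue_rV_box; last by move=> i; exact: ltW.
by rewrite lee_fin leNgt prodr_gt0.
Qed.

End sine_products.

(** * Completeness of the sine products *)

Section sine_polynomials.
Context {R : realType}.
Variable a : R.
Hypothesis a0 : 0 < a.

Definition sinpoly_lt (n : nat) (g : R -> R) :=
  exists c : nat -> R, forall y, g y = \sum_(k < n) c k * sin (freq a k * y).

Definition sinpoly g := exists n, sinpoly_lt n g.

Lemma sinpoly_ltW m n g : (m <= n)%N -> sinpoly_lt m g -> sinpoly_lt n g.
Proof.
move=> mn [c gc]; exists (fun k => if (k < m)%N then c k else 0) => y.
rewrite gc (big_ord_widen n (fun k => c k * sin (freq a k * y)))//.
by rewrite big_mkcond/=; apply: eq_bigr => k _; case: ifP; rewrite ?mul0r.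
Qed.

Lemma sinpolyD g h : sinpoly g -> sinpoly h -> sinpoly (fun y => g y + h y).
Proof.
move=> [m gm] [n hn].
have [c gc] := sinpoly_ltW (leq_maxl m n) gm.
have [d hd] := sinpoly_ltW (leq_maxr m n) hn.
exists (maxn m n), (fun k => c k + d k) => y.
by rewrite gc hd -big_split; apply: eq_bigr => k _; rewrite mulrDl.
Qed.

Lemma sinpolyZ r g : sinpoly g -> sinpoly (fun y => r * g y).
Proof.
move=> [n [c gc]]; exists n, (fun k => r * c k) => y.
by rewrite gc mulr_sumr; apply: eq_bigr => k _; rewrite mulrA.
Qed.

Lemma sinpoly_sin k : sinpoly (fun y => sin (freq a k * y)).
Proof.
exists k.+1, (fun l => (l == k)%:R) => y.
rewrite big_ord_recr/= eqxx mul1r big1 ?add0r// => i _.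
by rewrite ltn_eqF// mul0r.
Qed.

Lemma sinpoly0 : sinpoly (fun=> 0).
Proof. by exists 0, (fun=> 0) => y; rewrite big_ord0. Qed.

(** The identity [2 sin (n t) cos t = sin ((n + 1) t) + sin ((n - 1) t)]: the span
    of the sines is a module over the polynomials in the cosine. *)
Lemma sinpoly_mul_cos g : sinpoly g -> sinpoly (fun y => g y * cos (freq a 0 * y)).
Proof.
move=> [n [c gc]].
have -> : (fun y => g y * cos (freq a 0 * y)) =
  fun y => \sum_(k < n) c k * (sin (freq a k * y) * cos (freq a 0 * y)).
  by apply/funext => y; rewrite gc mulr_suml; apply: eq_bigr => k _; rewrite mulrA.
elim: n {gc} => [|n IH].
  by rewrite (_ : (fun y => _) = fun=> 0); [exact: sinpoly0|apply/funext => y; rewrite big_ord0].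
rewrite (_ : (fun y => _) = fun y => \sum_(k < n) c k * (sin (freq a k * y) * cos (freq a 0 * y))
   + c n * (sin (freq a n * y) * cos (freq a 0 * y))); last first.
  by apply/funext => y; rewrite big_ord_recr.
apply: sinpolyD => //; apply: sinpolyZ.
have fE k : freq a k = freq a 0 *+ k.+1.
  by rewrite /freq mul1r -[RHS]mulr_natl mulrA.
case: n {IH} => [|n].
  rewrite (_ : (fun y => _) = fun y => 2^-1 * sin (freq a 1 * y)).
    exact/sinpolyZ/sinpoly_sin.
  by apply/funext => y; rewrite [freq a 1]fE mulrnAl sin_mulr2n; field.
rewrite (_ : (fun y => _) = fun y => 2^-1 * (sin (freq a n.+2 * y) + sin (freq a n * y))).
  by apply: sinpolyZ; apply: sinpolyD; exact: sinpoly_sin.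
apply/funext => y; rewrite [freq a n.+2]fE [freq a n.+1]fE [freq a n]fE.
have -> : freq a 0 *+ n.+3 * y = freq a 0 *+ n.+2 * y + freq a 0 * y by rewrite mulrSr mulrDl.
have -> : freq a 0 *+ n.+1 * y = freq a 0 *+ n.+2 * y - freq a 0 * y.
  by rewrite [in RHS]mulrSr mulrDl addrK.
by rewrite sinD sinB; field.
Qed.

Definition sinpoly_multiplier (h : R -> R) :=
  forall g, sinpoly g -> sinpoly (fun y => g y * h y).

Lemma multiplier_cst c : sinpoly_multiplier (fun=> c).
Proof.
move=> g /(sinpolyZ c); congr sinpoly; apply/funext => y; exact: mulrC.
Qed.

Lemma multiplierD f h : sinpoly_multiplier f -> sinpoly_multiplier h ->
  sinpoly_multiplier (fun y => f y + h y).
Proof.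
move=> mf mh g sg; have := sinpolyD (mf _ sg) (mh _ sg).
by congr sinpoly; apply/funext => y; rewrite mulrDr.
Qed.

Lemma multiplierM f h : sinpoly_multiplier f -> sinpoly_multiplier h ->
  sinpoly_multiplier (fun y => f y * h y).
Proof.
move=> mf mh g sg; have := mh _ (mf _ sg).
by congr sinpoly; apply/funext => y; rewrite mulrA.
Qed.

Lemma multiplierX f n : sinpoly_multiplier f -> sinpoly_multiplier (fun y => f y ^+ n).
Proof.
move=> mf; elim: n => [|n IH].
  by under eq_fun do rewrite expr0; exact: multiplier_cst.
by under eq_fun do rewrite exprS; exact: multiplierM.
Qed.

Lemma bernoulli_ge (s : R) m : 0 <= s <= 1 -> 1 - m%:R * s <= (1 - s) ^+ m.
Proof.
move=> /andP[s0 s1]; elim: m => [|m IH]; first by rewrite mul0r subr0 expr0.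
rewrite exprS (le_trans _ (ler_wpM2l _ IH)) ?subr_ge0//.
rewrite -natr1; have : 0 <= m%:R :> R by []; move: (m%:R) => x x0; nra.
Qed.

(** The upper companion of the Bernoulli inequality: [(1 - s) ^ m] is at most
    [1 / (1 + m s)]. *)
Lemma bernoulli_le (s : R) m : 0 <= s <= 1 -> (1 - s) ^+ m * (1 + m%:R * s) <= 1.
Proof.
move=> /andP[s0 s1]; elim: m => [|m IH]; first by rewrite expr0 mul0r addr0 mulr1.
apply: le_trans IH; rewrite exprSr -mulrA ler_wpM2l ?exprn_ge0 ?subr_ge0//.
rewrite -natr1; have : 0 <= m%:R :> R by []; move: (m%:R) => x x0; nra.
Qed.

Lemma cvg_nat_expr (w : R) : 0 <= w < 1 -> n%:R * w ^+ n @[n --> \oo] --> 0.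
Proof.
move=> /andP[w0 w1].
(* [n w ^ n] is [n v ^ n] times [v ^ n]; the first factor is bounded by the
   Bernoulli inequality *)
pose v := Num.sqrt w.
have v0 : 0 <= v by exact: sqrtr_ge0.
have vE : v ^+ 2 = w by rewrite sqr_sqrtr.
have v1 : v < 1 by rewrite -(expr_lt1 (n := 2))// vE.
pose e := 1 - v.
have e0 : 0 < e by rewrite subr_gt0.
have nv n : n%:R * v ^+ n <= e^-1.
  have := bernoulli_le n (s := e); rewrite subr_ge0 lerBlDr lerDl v0 (ltW v1) => /(_ isT).
  rewrite /e opprB addrC subrK -/e => h.
  rewrite -[e^-1]mul1r ler_pdivlMr//; apply: le_trans h.
  rewrite [n%:R * _]mulrC -mulrA ler_wpM2l ?exprn_ge0//; lra.
have cv : e^-1 * v ^+ n @[n --> \oo] --> 0.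
  rewrite -[X in _ --> X](mulr0 e^-1); apply: cvgMl_tmp.
  by apply: cvg_expr; rewrite ger0_norm.
apply: (squeeze_cvgr _ (cvg_cst 0) cv).
apply: nearW => n; apply/andP; split; first by rewrite mulr_ge0// exprn_ge0.
rewrite -vE -exprM mulSn mul1n exprD mulrA ler_wpM2r ?exprn_ge0//.
Qed.

(** With [M] close to [k ^ n], the power [(1 - z ^ n) ^ (n M)] is governed by
    [n M z ^ n], that is by [n (k z) ^ n]: this tends to [0] for [z < 1 / k], and is
    at least [n] otherwise. The extra factor [n] makes the power tend to [0] at
    [z = 1 / k] as well. These polynomials have values in [[0, 1]], which gives
    bounded convergence without the Weierstrass theorem. *)
Lemma step_approx (k : R) : 1 < k -> exists e : nat -> nat * nat,
  forall z : R, 0 <= z <= 1 ->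
    (1 - z ^+ (e n).1) ^+ (e n).2 @[n --> \oo] --> ((z < k^-1)%R%:R : R).
Proof.
move=> k1; have k0 : 0 < k by lra.
pose M n := (Num.truncn (k ^+ n)).+1.
have Mlo n : k ^+ n <= (M n)%:R.
  by have /andP[_ /ltW] := truncn_itv (exprn_ge0 n (ltW k0)).
have Mhi n : (M n)%:R <= 2 * k ^+ n.
  have /andP[h _] := truncn_itv (exprn_ge0 n (ltW k0)).
  have : 1 <= k ^+ n by rewrite exprn_ege1// ltW.
  by rewrite /M -natr1; lra.
exists (fun n => (n, n * M n)%N) => z /andP[z0 z1] /=.
have zn n : 0 <= z ^+ n <= 1 by rewrite exprn_ge0// exprn_ile1.
have [zk|zk] := ltP z k^-1.
  pose w := k * z; have w1 : 0 <= w < 1.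
    by rewrite /w (mulr_ge0 (ltW k0) z0)/= mulrC -ltr_pdivlMr// mul1r.
  have lo : 1 - 2 * (n%:R * w ^+ n) @[n --> \oo] --> (1 : R).
    rewrite -[X in _ --> X]subr0; apply: cvgB; first exact: cvg_cst.
    by rewrite -[X in _ --> X](mulr0 2); apply: cvgMl_tmp; exact: cvg_nat_expr.
  rewrite (_ : true%:R = 1 :> R)//; apply: (squeeze_cvgr _ lo (cvg_cst (1 : R))); apply: nearW => n.
  have /andP[a1 a2] := zn n.
  apply/andP; split; last by rewrite exprn_ile1//; lra.
  apply: le_trans (bernoulli_ge _ (zn n)).
  rewrite lerD2l lerN2 natrM -mulrA [leRHS]mulrCA ler_wpM2l//.
  by rewrite /w exprMn mulrA ler_wpM2r.
have hi : n.+1%:R^-1 @[n --> \oo] --> (0 : R) by exact: cvg_harmonic.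
rewrite (_ : false%:R = 0 :> R)//; apply: (squeeze_cvgr _ (cvg_cst (0 : R)) hi); apply: nearW => n.
have /andP[a1 a2] := zn n.
rewrite exprn_ge0 ?subr_ge0//=.
have := bernoulli_le (n * M n) (zn n).
set p := _ ^+ _ => h; have p0 : 0 <= p by rewrite exprn_ge0// subr_ge0.
rewrite -[_^-1]mul1r ler_pdivlMr//; apply: le_trans h; rewrite ler_wpM2l//.
rewrite -natr1 addrC lerD2l natrM -mulrA ler_peMr//.
apply: (@le_trans _ _ (k ^+ n * z ^+ n)); last by rewrite ler_wpM2r.
by rewrite -exprMn exprn_ege1// -ler_pdivrMl// mulr1.
Qed.

(** The variable [z = (1 + cos (pi y / a)) / 2] decreases from [1] to [0] on
    [[0, a]], so steps in [z] are steps in [y]. *)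
Lemma sinpoly_step_approx (c : R) : exists g : nat -> R -> R,
  [/\ forall n, sinpoly (g n), forall n y, 0 < y < a -> `|g n y| <= 1 &
    forall y, 0 < y < a -> g n y @[n --> \oo] --> sin (freq a 0 * y) * (c < y)%R%:R].
Proof.
have [c0|c0] := leP c 0.
  exists (fun n y => sin (freq a 0 * y)); split.
  - by move=> n; exact: sinpoly_sin.
  - by move=> n y _; exact: sin_max.
  - by move=> y /andP[y0 _]; rewrite (le_lt_trans c0 y0) mulr1; exact: cvg_cst.
have [ca|ca] := leP a c.
  exists (fun n y => 0); split.
  - by move=> n; exact: sinpoly0.
  - by move=> n y _; rewrite normr0.
  - move=> y /andP[_ ya]; rewrite ltNge (le_trans (ltW ya) ca) /= mulr0.
    exact: cvg_cst.
have f0 := freq_gt0 0 a0.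
have faE : freq a 0 * a = pi by rewrite /freq mul1r divfK// gt_eqF.
pose z (y : R) := (1 + cos (freq a 0 * y)) / 2.
have z01 y : 0 <= z y <= 1.
  have h1 := cos_geN1 (freq a 0 * y); have h2 := cos_le1 (freq a 0 * y).
  by rewrite /z; apply/andP; split; lra.
have zmono x y : 0 <= x <= a -> 0 <= y <= a -> (z x < z y) = (y < x).
  move=> /andP[x0 xa] /andP[y0 ya].
  rewrite /z ltr_pM2r ?invr_gt0// ltrD2l ltr_cos ?ltr_pM2l//.
  - by rewrite in_itv/= (mulr_ge0 (ltW f0) y0)/= -faE ler_pM2l.
  - by rewrite in_itv/= (mulr_ge0 (ltW f0) x0)/= -faE ler_pM2l.
have zc0 : 0 < z c.
  have : z a < z c by rewrite zmono ?lexx ?ltW.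
  by apply: le_lt_trans; have /andP[] := z01 a.
have zc1 : z c < 1.
  have : z c < z 0 by rewrite zmono ?lexx ?ltW.
  by move/lt_le_trans; apply; have /andP[] := z01 0.
have [e he] := step_approx (k := (z c)^-1) (ltac:(by rewrite invf_gt1)).
exists (fun n y => sin (freq a 0 * y) * (1 - z y ^+ (e n).1) ^+ (e n).2); split.
- move=> n.
  suff : sinpoly_multiplier (fun y => (1 - z y ^+ (e n).1) ^+ (e n).2).
    by move/(_ _ (sinpoly_sin 0)).
  apply: multiplierX; under eq_fun do rewrite -mulN1r.
  apply: multiplierD; first exact: multiplier_cst.
  apply: multiplierM; first exact: multiplier_cst.
  apply: multiplierX; apply: multiplierM; last exact: multiplier_cst.
  apply: multiplierD; first exact: multiplier_cst.
  by move=> g; exact: sinpoly_mul_cos.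
- move=> n y _; rewrite normrM -[leRHS]mulr1 ler_pM// ?sin_max//.
  have /andP[y0 y1] := z01 y.
  have h : 0 <= z y ^+ (e n).1 <= 1 by rewrite exprn_ge0// exprn_ile1.
  by rewrite ger0_norm ?exprn_ge0 ?exprn_ile1//; lra.
- move=> y /andP[y0 ya]; apply: cvgMl_tmp.
  have := he (z y) (z01 y); rewrite invrK zmono//.
    by rewrite !ltW.
  by rewrite !ltW.
Qed.

End sine_polynomials.

Section orthants.
Context {R : realType} {N : nat}.

Definition orthant (c : 'I_N -> R) : set 'rV[R]_N := [set x | forall i, c i < x 0 i].

(** A pi-system on which integrals can be computed as limits of products of
    functions of one variable. *)
Definition orthants : set (set 'rV[R]_N) := [set orthant c | c in setT].

Lemma orthants_setI_closed : setI_closed orthants.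
Proof.
move=> _ _ [c _ <-] [d _ <-]; exists (fun i => Num.max (c i) (d i)) => //.
apply/seteqP; split=> x /=.
  by move=> h; split=> i; have := h i; rewrite gt_max => /andP[].
by move=> [h1 h2] i; rewrite gt_max h1 h2.
Qed.

Lemma measurable_orthant c : measurable (orthant c).
Proof.
rewrite (_ : orthant c = \bigcap_(i in [set: 'I_N]) (rV_coord i @^-1` `]c i, +oo[%classic)).
  apply: fin_bigcap_measurable => // i _.
  by rewrite -[X in measurable X]setTI; exact: measurable_rV_coord.
by apply/seteqP; split => x /= h i => [_|]; have := h i;
  rewrite /rV_coord/= in_itv/= andbT//; exact.
Qed.

Lemma rV_measurable_orthants :
  @measurable default_measure_display 'rV[R]_N = <<s orthants >>.
Proof.
apply/seteqP; split; last first.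
  apply: smallest_sub; first exact: sigma_algebra_measurable.
  by move=> _ [c _ <-]; exact: measurable_orthant.
pose T := g_sigma_algebraType orthants.
apply: smallest_sub; first exact: smallest_sigma_algebra.
rewrite -bigcup_seq; apply: bigcup_sub => i _ _ [B mB <-].
have mi : measurable_fun [set: T] ((fun x => rV_coord i x) : T -> R).
  apply: (measurability _ (RGenOInfty.measurableE R)).
  move=> _ [_ [r ->] <-]; rewrite setTI.
  rewrite (_ : _ @^-1` _ = \bigcup_n orthant (fun j => if j == i then r else - n%:R)).
    apply: bigcupT_measurable => n; apply: sub_sigma_algebra.
    by exists (fun j => if j == i then r else - n%:R).
  apply/seteqP; split=> x /=; rewrite in_itv/= andbT.
    move=> rx.
    have : exists n, forall j, - n%:R < x 0 j.
      pose d j := (Num.truncn `|x 0 j|).+1.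
      exists (\max_j d j)%N => j.
      rewrite ltrNl; apply: (le_lt_trans (ler_norm _)); rewrite normrN.
      have /andP[_ h] := truncn_itv (normr_ge0 (x 0 j)).
      apply: (lt_le_trans h); rewrite ler_nat.
      exact: (leq_bigmax (F := d) j).
    by move=> [n hn]; exists n => // j; case: eqP => [->|_].
  by move=> [n _ /(_ i)]; rewrite eqxx.
by have := mi measurableT B mB.
Qed.

End orthants.

Section completeness.
Context {R : realType} {N : nat}.
Variable a : 'I_N -> R.
Hypothesis a0 : forall i, 0 < a i.
Local Notation mu := (@lebesgue_rV R N).
Local Notation Omega := (rV_box a).
Let mO : measurable Omega. Proof. exact: rV_box_measurable. Qed.
Let finO : (mu Omega < +oo)%E. Proof. exact: rV_box_finite. Qed.

Variable u : 'rV[R]_N -> R.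
Hypothesis iu : mu.-integrable Omega (EFin \o u).
Hypothesis u_orth : forall kk, \int[mu]_(x in Omega) (u x * sin_prod a kk x) = 0.

(** Expanding the product of the factors gives a combination of sine products. *)
Lemma Rintegral_sinpoly_eq0 (g : 'I_N -> R -> R) :
  (forall i, sinpoly (a i) (g i)) -> \int[mu]_(x in Omega) (u x * prodf g x) = 0.
Proof.
move=> sg; have /choice[n sn] : forall i, exists n, sinpoly_lt (a i) n (g i) := sg.
pose m := \max_i n i.
have /choice[c hc] : forall i, exists c : nat -> R, forall y,
    g i y = \sum_(k < m) c k * sin (freq (a i) k * y).
  by move=> i; apply: (sinpoly_ltW _ (sn i)); exact: (leq_bigmax i).
pose val_ (f : {ffun 'I_N -> 'I_m}) := [ffun i => nat_of_ord (f i)].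
have E x : u x * prodf g x =
    \sum_(f : {ffun 'I_N -> 'I_m}) (\prod_i c i (f i)) * (u x * sin_prod a (val_ f) x).
  rewrite /prodf; under eq_bigr do rewrite hc.
  rewrite bigA_distr_bigA mulr_sumr; apply: eq_bigr => f _.
  rewrite big_split /= mulrCA; congr (_ * (_ * _)).
  by apply: eq_bigr => i _; rewrite /sin_factor ffunE.
under eq_Rintegral do rewrite E.
have is_ f : mu.-integrable Omega (fun x => (u x * sin_prod a (val_ f) x)%:E).
  by apply: integrableM_bounded => //; apply: bounded_mfun_prodf; exact: smooth1_sin_factor.
rewrite Rintegral_sum.
  by rewrite big1// => f _; rewrite (RintegralZl _ mO (is_ f)) u_orth mulr0.
by move=> f; exact: (integrableZl mO (\prod_i c i (f i)) (is_ f)).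
Qed.

Let w x := u x * sin_prod a [ffun=> 0%N] x.

Let iw : mu.-integrable Omega (EFin \o w).
Proof.
by apply: integrableM_bounded => //; apply: bounded_mfun_prodf; exact: smooth1_sin_factor.
Qed.

Lemma Rintegral_orthant_eq0 c : \int[mu]_(x in Omega `&` orthant c) w x = 0.
Proof.
have /choice[g hg] := fun i => sinpoly_step_approx (a0 i) (c i).
pose G n i := g i n.
have GC x : Omega x -> prodf (G n) x @[n --> \oo] -->
    \prod_i (sin (freq (a i) 0 * x 0 i) * (c i < x 0 i)%R%:R).
  move=> Ox; apply: cvg_big => [|i _]; first exact: mul_continuous.
  by have [_ _] := hg i; apply; exact: Ox.
have mG n : measurable_fun Omega (prodf (G n)).
  apply: measurable_funTS; apply: rV_continuous_measurable; apply: continuous_prodf => i y.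
  have [/(_ n) [m [d hd]] _ _] := hg i.
  rewrite (_ : G n i = fun y => \sum_(k < m) d k * sin (freq (a i) k * y)); last exact/funext.
  apply: continuous_big => [|k _ z]; first exact: add_continuous.
  apply: cvgMl_tmp; apply: continuous_comp; last exact: continuous_sin.
  exact: mulrl_continuous.
have GM n x : Omega x -> `|prodf (G n) x| <= 1.
  move=> Ox; rewrite -[leRHS](expr1n R N); apply: prodf_bound => // i.
  by have [_ h _] := hg i; exact: h.
have := Rintegral_bounded_cvg mO iu mG GM GC.
have G0 n : \int[mu]_(x in Omega) (u x * prodf (G n) x) = 0.
  by apply: Rintegral_sinpoly_eq0 => i; have [/(_ n)] := hg i.
rewrite (_ : (fun n => _) = fun=> 0); last exact/funext.
move=> L.
transitivity (\int[mu]_(x in Omega)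
    (u x * \prod_i (sin (freq (a i) 0 * x 0 i) * (c i < x 0 i)%R%:R))); last first.
  exact: (cvg_unique _ L (cvg_cst 0)).
rewrite Rintegral_mkcondr; apply: eq_Rintegral => x /[!inE] Ox.
rewrite patchE; case: ifPn => [|/negP]; rewrite inE => cx.
  by rewrite /w /sin_prod /prodf; congr (_ * _); apply: eq_bigr => i _;
    rewrite /sin_factor ffunE cx mulr1.
have [i /negP ci] : exists i, ~ c i < x 0 i by apply/existsNP.
by rewrite (bigD1 i)//= (negbTE ci) mulr0 mul0r mulr0.
Qed.

(** [w] is [u] times the first sine product, which is positive on the box. Its
    integral vanishes over all orthants, hence over all measurable sets by the
    pi-lambda theorem. *)
Lemma sin_prod_complete : {ae mu, forall x, Omega x -> u x = 0}.
Proof.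
have H A : measurable A -> (\int[mu]_(x in Omega `&` A) (w x)%:E = 0)%E.
  rewrite rV_measurable_orthants; move: A.
  have iwA A : measurable A -> mu.-integrable (Omega `&` A) (EFin \o w).
    by move=> mA; apply: (integrableS mO _ _ iw) => //; exact: measurableI.
  have W0 : (\int[mu]_(x in Omega) (w x)%:E = 0)%E.
    have OE : Omega `&` orthant (fun=> 0) = Omega.
      by apply/seteqP; split=> x; [case|move=> Ox; split => // i; have /andP[] := Ox i].
    rewrite -OE -[LHS](fineK (integrable_fin_num _ (iwA _ (measurable_orthant _)))); last first.
      by apply: measurableI => //; exact: measurable_orthant.
    by congr EFin; exact: Rintegral_orthant_eq0.
  apply: dynkin_induction => //.
  - exact: rV_measurable_orthants.
  - exact: orthants_setI_closed.
  - by rewrite setIT.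
  - move=> _ [c _ <-].
    rewrite -[LHS](fineK (integrable_fin_num _ (iwA _ (measurable_orthant _)))); last first.
      by apply: measurableI => //; exact: measurable_orthant.
    by congr EFin; exact: Rintegral_orthant_eq0.
  - move=> A mA A0.
    have mOA : measurable (Omega `&` A) by exact: measurableI.
    have mOC : measurable (Omega `&` ~` A) by apply: measurableI => //; exact: measurableC.
    have OAC : (Omega `&` A) `|` (Omega `&` ~` A) = Omega by rewrite -setIUr setUv setIT.
    move: W0; rewrite -{1}OAC integral_setU_EFin//.
    + by rewrite A0 add0e.
    + rewrite OAC; apply/measurable_EFinP; exact: measurable_int iw.
    + by apply/disj_setPS => x [[_ Ax] [_ /(_ Ax)]].
  - move=> F mF tF F0; rewrite setI_bigcupr integral_bigcup.
    + by apply: eseries0 => n _ _; exact: F0.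
    + exact: trivIset_setIl.
    + by move=> k; exact: measurableI.
    + by rewrite -setI_bigcupr; apply: iwA; exact: bigcupT_measurable.
have W : ae_eq mu Omega (EFin \o w) (cst 0%E).
  apply: integral_ae_eq => // E EO mE.
  by rewrite integral0 -(setIidr EO); exact: H.
apply: filterS W => x h Ox; have /= := h Ox => -[] /eqP.
rewrite /w mulf_eq0 => /orP[/eqP//|].
rewrite gt_eqF//; apply: prodr_gt0 => i _; apply: sin_gt0_pi; rewrite ffunE.
have /andP[x0 xa] := Ox i; rewrite mulr_gt0 ?freq_gt0//= /freq mul1r.
by rewrite -mulrA gtr_pMr ?pi_gt0// mulrC ltr_pdivrMr// mul1r.
Qed.

End completeness.

(** * The spectrum of a box *)

Lemma infinite_range_inj (U : Type) (f : nat -> U) :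
  injective f -> infinite_set (range f).
Proof.
move=> f_inj fin; apply: infinite_nat.
have : finite_set (f @^-1` range f) by apply: finite_preimage => // m n _ _; exact: f_inj.
by apply: sub_finite_set => n _; exists n.
Qed.

Lemma card_eq_uniq_seq (U : Type) (T : choiceType) (A : set U) (h : U -> T) (s : seq T) :
  uniq s -> set_bij A [set` s] h -> (A #= `I_(size s))%card.
Proof.
move=> us [hf hi hs]; apply/card_set_bijP; exists (fun x => index (h x) s); split.
- by move=> x /hf /=; rewrite index_mem.
- move=> x y xA yA hxy; apply: hi => //; have /= hx := hf _ (set_mem xA).
  have /= hy := hf _ (set_mem yA).
  by rewrite -(nth_index (h x) hx) hxy nth_index.
- move=> i /= ik; case: s us hf hi hs ik => // t0 s us hf hi hs ik.
  have [x Ax hx] := hs (nth t0 (t0 :: s) i) (mem_nth t0 ik).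
  by exists x => //; rewrite hx index_uniq.
Qed.

Section jth_smallest.
Context {R : realType} {T : choiceType}.
Implicit Types (E : T -> R) (A : seq T) (t : T).

(** The value of rank [j] of [E], with multiplicity. The witnesses [A] and [t] make
    it possible to check this on an explicit list of indices, without sorting. *)
Definition jth_smallest E (j : nat) (x : R) := exists A t,
  [/\ uniq (t :: A), (size A).+1 = j, E t = x,
      forall t', t' \in A -> E t' <= x & forall t', t' \notin A -> x <= E t'].

Lemma jth_smallest_bij E E' (f g : T -> T) (r : R) j x : cancel f g -> cancel g f ->
  0 < r -> (forall t, E' (f t) = r * E t) ->
  jth_smallest E j x -> jth_smallest E' j (r * x).
Proof.
move=> fK gK r0 EE [A [t [utA sA tx lo hi]]].
exists (map f A), (f t); split.
- by rewrite -[_ :: _]/(map f (t :: A)) map_inj_uniq//; exact: can_inj fK.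
- by rewrite size_map.
- by rewrite EE tx.
- by move=> _ /mapP[t' t'A ->]; rewrite EE ler_pM2l// lo.
- move=> t' t'A; rewrite -(gK t') EE ler_pM2l// hi//.
  by apply: contra t'A => h; rewrite -(gK t'); exact: map_f.
Qed.

Definition finite_sublevels E := forall x, finite_set [set t | E t <= x].

Lemma seq_min E (s : seq T) : s != [::] ->
  exists2 t, t \in s & forall t', t' \in s -> E t <= E t'.
Proof.
elim: s => // t s IH _; have [->|/IH [t1 t1s h]] := eqVneq s [::].
  by exists t; [rewrite inE|move=> t'; rewrite inE => /eqP->].
have [tt1|t1t] := leP (E t) (E t1).
  exists t; first by rewrite inE eqxx.
  by move=> t'; rewrite inE => /predU1P[->//|/h]; exact: le_trans.
exists t1; first by rewrite inE t1s orbT.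
by move=> t'; rewrite inE => /predU1P[->|/h//]; exact: ltW.
Qed.

Lemma next_smallest E : finite_sublevels E -> infinite_set [set: T] ->
  forall A, exists2 t, t \notin A & forall t', t' \notin A -> E t <= E t'.
Proof.
move=> fE infT A.
have [t0 t0A] : exists t, t \notin A.
  apply: contrapT => h; apply: infT; apply: (@sub_finite_set _ _ [set` A]).
    by move=> t _ /=; apply: contrapT => tA; apply: h; exists t; exact/negP.
  exact: finite_seq.
have /finite_seqP[s sE] : finite_set [set t | E t <= E t0 /\ t \notin A].
  by apply: sub_finite_set (fE (E t0)) => t [].
have ms t : (t \in s) <-> (E t <= E t0 /\ t \notin A).
  by rewrite -[_ <-> _]/([set` s] t <-> _) -sE.
have s0 : s != [::] by apply/eqP => sn; have /ms : E t0 <= E t0 /\ t0 \notin A by []; rewrite sn.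
have [t ts tmin] := seq_min E s0.
exists t; first by have /ms[] := ts.
move=> t' t'A; have [t't0|/ltW h] := leP (E t') (E t0); first exact/tmin/ms.
by apply: le_trans h; have /ms[] := ts.
Qed.

(** Greedy enumeration: always take a minimizer among the indices that remain.
    Nothing is missed, because only finitely many indices have a value below a given
    one. *)
Lemma sorted_enumeration E : finite_sublevels E -> infinite_set [set: T] ->
  exists e : nat -> T, [/\ injective e, forall t, exists n, e n = t &
    forall m n, (m <= n)%N -> E (e m) <= E (e n)].
Proof.
move=> fE infT.
have /choice[next nextP] : forall A, exists t, t \notin A /\ forall t', t' \notin A -> E t <= E t'.
  by move=> A; have [t h1 h2] := next_smallest fE infT A; exists t.
pose pre := fix pre n := if n is m.+1 then rcons (pre m) (next (pre m)) else [::].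
pose e n := next (pre n).
have preE m n : (m < n)%N -> e m \in pre n.
  elim: n => // n IH; rewrite ltnS leq_eqVlt => /predU1P[->|/IH h] /=.
    by rewrite mem_rcons inE eqxx.
  by rewrite mem_rcons inE h orbT.
have pre_sub m n t : (m <= n)%N -> t \notin pre n -> t \notin pre m.
  elim: n => [|n IH]; first by rewrite leqn0 => /eqP->.
  rewrite leq_eqVlt => /predU1P[->//|]; rewrite ltnS => /IH h /=.
  by rewrite mem_rcons inE negb_or => /andP[_ /h].
have e_inj : injective e.
  move=> m n emn; case: (ltngtP m n) => // /preE.
    by rewrite emn (negbTE (nextP (pre n)).1).
  by rewrite -emn (negbTE (nextP (pre m)).1).
exists e; split=> //.
  move=> t; apply: contrapT => h.
  have tn n : t \notin pre n.
    elim: n => //= n IH; rewrite mem_rcons inE negb_or IH andbT.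
    by apply/eqP => te; apply: h; exists n.
  have : infinite_set (range e).
    exact: infinite_range_inj.
  apply; apply: sub_finite_set (fE (E t)) => _ [n _ <-] /=.
  exact: (nextP (pre n)).2.
move=> m n mn; apply: (nextP (pre m)).2; apply: (pre_sub _ n) => //.
exact: (nextP (pre n)).1.
Qed.

Lemma jth_smallest_exists E j : finite_sublevels E -> infinite_set [set: T] ->
  (0 < j)%N -> exists x, jth_smallest E j x.
Proof.
move=> fE infT; case: j => // j _.
have [e [e_inj e_surj e_mono]] := sorted_enumeration fE infT.
exists (E (e j)), (mkseq e j), (e j); split=> //.
- by rewrite /mkseq /= mem_map// mem_iota ltnn map_inj_uniq// iota_uniq.
- by rewrite size_mkseq.
- move=> t' /mapP[n nj ->]; rewrite mem_iota in nj; apply: e_mono; exact: ltnW.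
- move=> t; have [n <-] := e_surj t; rewrite /mkseq mem_map// mem_iota /= add0n -leqNgt.
  exact: e_mono.
Qed.

(** A nondecreasing sequence with the same multiplicities as [E] takes the value
    of rank [j] at the index [j - 1]. Matching the level sets gives a bijection [F]
    from the indices of [E] to the positions, and both inequalities are counting
    arguments. *)
Lemma jth_smallest_unique E (lam : nat -> R) j x :
  {homo lam : m n / (m <= n)%N >-> m <= n} ->
  (forall y, ([set n | lam n = y] #= [set t | E t = y])%card) ->
  jth_smallest E j x -> lam j.-1 = x.
Proof.
move=> lam_mono lamE [A [t [utA <- tx lo hi]]] /=.
have /choice[f hf] : forall y, exists f : T -> nat,
    set_bij [set t | E t = y] [set n | lam n = y] f.
  by move=> y; have := lamE y; rewrite card_eq_sym => /card_set_bijP.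
pose F t := f (E t) t.
have FE t' : lam (F t') = E t' by have [h _ _] := hf (E t'); exact: (h t' erefl).
have F_inj : injective F.
  move=> t1 t2 h; have EE : E t1 = E t2 by rewrite -!FE h.
  have [_ inj _] := hf (E t1).
  by apply: inj; rewrite ?inE//=; move: h; rewrite /F EE.
have /choice[G hG] : forall n, exists t', E t' = lam n /\ F t' = n.
  by move=> n; have [_ _ /(_ n erefl) [t' /= Et' ft']] := hf (lam n); exists t'; rewrite /F Et'.
apply/eqP; rewrite eq_le; apply/andP; split.
  have [t' t's Ft'] : exists2 t', t' \in t :: A & (size A <= F t')%N.
    apply: contrapT => h.
    have sub : {subset map F (t :: A) <= iota 0 (size A)}.
      move=> _ /mapP[t' t's ->]; rewrite mem_iota /= add0n ltnNge.
      by apply/negP => h'; apply: h; exists t'.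
    have := uniq_leq_size _ sub; rewrite size_map size_iota ltnn => /(_ _)/notF; apply.
    by rewrite map_inj_uniq.
  apply: (le_trans (lam_mono _ _ Ft')); rewrite FE.
  by move: t's; rewrite inE => /predU1P[->|/lo//]; rewrite tx.
rewrite leNgt; apply/negP => lx.
have sub : {subset map G (iota 0 (size A).+1) <= A}.
  move=> t' /mapP[n nA ->]; rewrite mem_iota add0n ltnS /= in nA.
  apply: contraT => /hi; rewrite (hG n).1 leNgt (le_lt_trans _ lx)//.
  exact: lam_mono.
have := uniq_leq_size _ sub; rewrite size_map size_iota ltnn => /(_ _)/notF; apply.
rewrite map_inj_uniq ?iota_uniq// => m n h.
by rewrite -(hG m).2 -(hG n).2 h.
Qed.

End jth_smallest.

Section box_spectrum.
Context {R : realType} {N : nat}.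
Variable a : 'I_N -> R.
Hypothesis a0 : forall i, 0 < a i.
Hypothesis N0 : (0 < N)%N.
Local Notation mu := (@lebesgue_rV R N).
Local Notation Omega := (rV_box a).
Local Notation T := {ffun 'I_N -> nat}.
Let mO : measurable Omega. Proof. exact: rV_box_measurable. Qed.
Let finO : (mu Omega < +oo)%E. Proof. exact: rV_box_finite. Qed.

Lemma finite_sublevels_box_energy : finite_sublevels (box_energy a).
Proof.
move=> x.
pose B i := (Num.truncn (`|x| / (pi / a i) ^+ 2)).+1.
pose m := \max_i B i.
apply: (@sub_finite_set _ _
  ((fun f : {ffun 'I_N -> 'I_m} => [ffun i => nat_of_ord (f i)]) @` setT)).
  move=> kk /= kx.
  have km i : (kk i < m)%N.
    have f0 : 0 < pi / a i by rewrite divr_gt0// pi_gt0.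
    have h : freq (a i) (kk i) ^+ 2 <= `|x|.
      apply: le_trans (le_trans kx (ler_norm x)); rewrite /box_energy (bigD1 i)//= lerDl.
      by apply: sumr_ge0 => j _; exact: sqr_ge0.
    have /andP[_ tr] := truncn_itv (divr_ge0 (normr_ge0 x) (sqr_ge0 (pi / a i))).
    apply: (@leq_trans (B i)); last exact: (leq_bigmax (F := B) i).
    rewrite -(ltr_nat R); apply: le_lt_trans tr.
    rewrite ler_pdivlMr ?exprn_gt0//; apply: le_trans h.
    have -> : freq (a i) (kk i) ^+ 2 = (kk i).+1%:R ^+ 2 * (pi / a i) ^+ 2.
      by rewrite /freq -mulrA exprMn.
    rewrite ler_pM2r ?exprn_gt0// -natrX ler_nat.
    by apply: (@leq_trans (kk i).+1) => //; rewrite -mulnn leq_pmulr.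
  by exists [ffun i => Ordinal (km i)] => //; apply/ffunP => i; rewrite !ffunE.
exact/finite_image/finite_finset.
Qed.

Lemma infinite_mode_set : infinite_set [set: T].
Proof.
pose g (n : nat) : T := [ffun=> n].
have g_inj : injective g.
  by move=> m n /ffunP/(_ (Ordinal N0)); rewrite !ffunE.
have : infinite_set (range g).
  exact: infinite_range_inj.
by apply: contra_not; exact: sub_finite_set.
Qed.

Lemma eigenspace_dim_geW (Om : set 'rV[R]_N) nu k l : (k <= l)%N ->
  eigenspace_dim_ge Om nu l -> eigenspace_dim_ge Om nu k.
Proof.
move=> kl [u [eu fu]]; exists (fun i => u (widen_ord kl i)); split => // c hc i.
pose c' (j : 'I_l) : R := if insub (val j) is Some i' then c i' else 0.
have c'E i' : c' (widen_ord kl i') = c i'.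
  by rewrite /c' /= insubT ?ltn_ord//= => h; congr c; exact: val_inj.
rewrite -c'E; apply: fu; apply: filterS hc => x hx Ox; rewrite -[RHS](hx Ox).
rewrite (bigID (fun j : 'I_l => (j < k)%N))/= [X in _ + X]big1 ?addr0; last first.
  by move=> j /negbTE jk; rewrite /c' insubF// mul0r.
rewrite big_ord_narrow.
by apply: eq_bigr => i' _; rewrite c'E.
Qed.

Lemma eigenspace_dim_unique (Om : set 'rV[R]_N) nu k l :
  eigenspace_dim Om nu k -> eigenspace_dim Om nu l -> k = l.
Proof.
move=> [k1 k2] [l1 l2]; case: (ltngtP k l) => // h; exfalso.
  by apply: k2; exact: eigenspace_dim_geW l1.
by apply: l2; exact: eigenspace_dim_geW k1.
Qed.

(** The modes of energy [nu] give independent eigenfunctions by orthogonality.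
    Given one eigenfunction more, some nontrivial combination is orthogonal to these
    modes by linear algebra; it is orthogonal to the other modes by
    [eigenfunction_sin_prod], hence vanishes by completeness. *)
Lemma box_eigenspace_dim nu (s : seq T) : uniq s ->
  (forall kk, kk \in s <-> box_energy a kk = nu) -> eigenspace_dim Omega nu (size s).
Proof.
move=> us sE; have sth i : (i < size s)%N -> box_energy a (nth [ffun=> 0%N] s i) = nu.
  by move=> h; apply/sE; exact: mem_nth.
pose S (i : 'I_(size s)) := nth [ffun=> 0%N] s i.
have bS kk : bounded_mfun Omega (sin_prod a kk).
  by apply: bounded_mfun_prodf; exact: smooth1_sin_factor.
have iS kk := bounded_mfun_integrable mO finO (bS kk).
have eigint u : dirichlet_eigenfunction Omega nu u -> mu.-integrable Omega (EFin \o u).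
  by move=> [G [L2u _ _] _]; exact: (square_integrable_integrable mO finO L2u).
have Rint_lin n (c : 'I_n -> R) (u : 'I_n -> 'rV[R]_N -> R) kk :
    (forall i, mu.-integrable Omega (EFin \o u i)) ->
    mu.-integrable Omega (EFin \o (fun x => \sum_(i < n) c i * u i x)) /\
    \int[mu]_(x in Omega) ((\sum_(i < n) c i * u i x) * sin_prod a kk x) =
    \sum_(i < n) c i * \int[mu]_(x in Omega) (u i x * sin_prod a kk x).
  move=> ui; split.
    rewrite (_ : _ \o _ = fun x => (\sum_(i < n) (c i * u i x)%:E)%E).
      by apply: integrable_sum => // i _; exact: (integrableZl mO (c i) (ui i)).
    by apply/funext => x /=; rewrite sumEFin.
  under eq_Rintegral do rewrite mulr_suml.
  have iuS i := integrableM_bounded mO (ui i) (bS kk).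
  rewrite Rintegral_sum//.
    apply: eq_bigr => i _; under eq_Rintegral do rewrite -mulrA.
    by rewrite (RintegralZl _ mO (iuS i)).
  move=> i; under eq_fun do rewrite -mulrA.
  exact: (integrableZl mO (c i) (iuS i)).
split.
  exists (fun i => sin_prod a (S i)); split.
    by move=> i; rewrite -(sth i (ltn_ord i)); exact: sin_prod_eigenfunction.
  move=> c c0 i.
  have [_ lin] := Rint_lin _ c (fun i => sin_prod a (S i)) (S i) (fun i => iS (S i)).
  have I0 : \int[mu]_(x in Omega) ((\sum_i c i * sin_prod a (S i) x) * sin_prod a (S i) x) = 0.
    rewrite -[RHS]/(fine 0%E); congr fine.
    rewrite (ae_eq_integral (cst 0%E))//; first exact: integral0.
      apply/measurable_EFinP; apply: measurable_funM; last by case: (bS (S i)).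
      by apply: measurable_sum => l; apply: measurable_funM => //; case: (bS (S l)).
    by apply: filterS c0 => x hx Ox /=; rewrite hx// mul0r.
  move: lin; rewrite I0 (bigD1 i)//= big1 ?addr0; last first.
    move=> l li; rewrite sin_prod_orthogonal ?mulr0//.
    by rewrite /S nth_uniq.
  move/esym/eqP; rewrite mulf_eq0 => /orP[/eqP//|].
  by rewrite gt_eqF// sin_prod_norm_gt0.
move=> [u [eu fu]].
pose M := \matrix_(i < (size s).+1, l < size s)
  \int[mu]_(x in Omega) (u i x * sin_prod a (S l) x).
have [c c0 cM] : exists2 c : 'rV[R]_(size s).+1, c != 0 & c *m M = 0.
  have : kermx M != 0.
    rewrite kermx_eq0 /row_free; apply/eqP => h.
    by have := rank_leq_col M; rewrite h ltnn.
  by move=> /rowV0Pn[c /sub_kermxP cM c0]; exists c.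
have iu i := eigint _ (eu i).
have [iv _] := Rint_lin _ (fun i => c 0 i) u [ffun=> 0%N] iu.
have ae0 := sin_prod_complete a0 iv.
suff v0 : forall kk, \int[mu]_(x in Omega) ((\sum_i c 0 i * u i x) * sin_prod a kk x) = 0.
  have /fu cz := ae0 v0.
  by move/eqP : c0; apply; apply/rowP => i; rewrite mxE cz.
move=> kk; have [_ ->] := Rint_lin _ (fun i => c 0 i) u kk iu.
have [kks|kks] := boolP (kk \in s).
  have ls : (index kk s < size s)%N by rewrite index_mem.
  have := congr1 (fun A : 'rV_(size s) => A 0 (Ordinal ls)) cM; rewrite /= !mxE => H.
  rewrite -[RHS]H; apply: eq_bigr => i _; rewrite mxE /S /=.
  by rewrite nth_index.
apply: big1 => i _; have := eigenfunction_sin_prod a0 kk (eu i) => /eqP.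
rewrite -subr_eq0 -mulrBl mulf_eq0 => /orP[|/eqP->]; last by rewrite mulr0.
by rewrite subr_eq0 => /eqP/sE; rewrite (negbTE kks).
Qed.

Lemma box_spectrum_exists : exists lam, dirichlet_spectrum Omega lam.
Proof.
have [e [e_inj e_surj e_mono]] := sorted_enumeration finite_sublevels_box_energy infinite_mode_set.
exists (box_energy a \o e); split; first by move=> m n; exact: e_mono.
move=> nu.
have /finite_seqP[s0 s0E] : finite_set [set kk | box_energy a kk = nu].
  by apply: sub_finite_set (finite_sublevels_box_energy nu) => kk /= ->.
have ms kk : kk \in undup s0 <-> box_energy a kk = nu.
  by rewrite mem_undup -[_ <-> _]/([set` s0] kk <-> _) -s0E.
exists (size (undup s0)); first by apply: box_eigenspace_dim => //; exact: undup_uniq.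
apply: (card_eq_uniq_seq (h := e)); first exact: undup_uniq.
split; first by move=> n /= /ms.
  by move=> m n _ _; exact: e_inj.
by move=> kk /= /ms <-; have [n <-] := e_surj kk; exists n.
Qed.

(** The multiplicities of the sequence picked by [xget] are the dimensions of the
    eigenspaces, which are those of the sorted energies, so that the two sequences
    agree. *)
Lemma dirichlet_eigenvalue_box j x : (0 < j)%N ->
  jth_smallest (box_energy a) j x -> dirichlet_eigenvalue Omega j = x.
Proof.
move=> j0 jx; rewrite /dirichlet_eigenvalue; set P := [set lam | _].
have [lam0 lam0P] := box_spectrum_exists.
have [lam_mono lam_dim] : P (xget (fun=> 0) P) by exact: (xgetPex _ (ex_intro _ lam0 lam0P)).
apply: jth_smallest_unique jx => // nu.
have [k kdim kcard] := lam_dim nu.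
have /finite_seqP[s0 s0E] : finite_set [set kk | box_energy a kk = nu].
  by apply: sub_finite_set (finite_sublevels_box_energy nu) => kk /= ->.
have ms kk : kk \in undup s0 <-> box_energy a kk = nu.
  by rewrite mem_undup -[_ <-> _]/([set` s0] kk <-> _) -s0E.
rewrite (eigenspace_dim_unique kdim (box_eigenspace_dim (undup_uniq s0) ms)) in kcard.
apply: (card_eq_trans kcard); rewrite card_eq_sym.
apply: (card_eq_uniq_seq (h := id)); first exact: undup_uniq.
split; first by move=> kk /= /ms.
  by move=> m n _ _.
by move=> kk /= /ms; exists kk.
Qed.

End box_spectrum.

(** * The inequality on boxes *)

Section closed_boxes.
Context {R : realType} {N : nat}.
Implicit Types a b : 'I_N -> R.

Definition closed_box a : set 'rV[R]_N := [set x | forall i, 0 <= x 0 i <= a i].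

Lemma rV_box_open a : open (rV_box a).
Proof.
rewrite openE => x xO.
refine (@filter_forall _ _ (fun i (y : 'rV[R]_N) => 0 < y 0 i < a i) (nbhs x) _ _) => i.
have oi : open ((fun y : 'rV[R]_N => y 0 i) @^-1` `]0, a i[%classic).
  apply: open_comp; last exact: interval_open.
  by move=> y _; exact: coord_continuous.
have : nbhs x ((fun y : 'rV[R]_N => y 0 i) @^-1` `]0, a i[%classic).
  by apply: open_nbhs_nbhs; split => //=; rewrite in_itv/=; exact: xO.
by apply: filterS => y; rewrite /= in_itv.
Qed.

Lemma interior_closed_box a : (forall i, 0 < a i) -> (closed_box a)^° = rV_box a.
Proof.
move=> a0; apply/seteqP; split; last first.
  rewrite -open_subsetE; last exact: rV_box_open.
  by move=> x h i; have /andP[/ltW-> /ltW->] := h i.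
move=> x /nbhs_ballP[e /= e0 eK] i.
(* moving along the diagonal in both directions stays in the closed box, so
   every coordinate inequality is strict *)
have e2 : 0 < e / 2 by rewrite divr_gt0.
have bl (y : 'rV[R]_N) : (forall j, `|x 0 j - y 0 j| < e) -> closed_box a y.
  by move=> h; apply: eK; split => // i' j; rewrite ord1; exact: h.
have h1 : closed_box a (x - const_mx (e / 2)).
  by apply: bl => j; rewrite !mxE opprB addrC subrK gtr0_norm//; lra.
have h2 : closed_box a (x + const_mx (e / 2)).
  by apply: bl => j; rewrite !mxE opprD addNKr normrN gtr0_norm//; lra.
have := h1 i; have := h2 i; rewrite !mxE => /andP[_ k1] /andP[k2 _].
by apply/andP; split; lra.
Qed.

Lemma convex_body_closed_box a : (forall i, 0 < a i) -> convex_body (closed_box a).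
Proof.
move=> a0; split.
- rewrite (_ : closed_box a = [set v | forall i, `[0, a i]%classic (v ord0 i)]).
    by apply: (@rV_compact R _ (fun i => `[0, a i]%classic)) => i; exact: segment_compact.
  by apply/seteqP; split=> x h i; have := h i; rewrite /= in_itv.
- move=> x y l /set_mem xK /set_mem yK; apply/mem_set => i.
  have /andP[x0 xa] := xK i; have /andP[y0 ya] := yK i.
  have l0 : 0 <= l%:num by []; have l1 : l%:num <= 1 by [].
  change (0 <= (l%:num *: (x : 'rV[R]_N) + (1 - l%:num) *: (y : 'rV[R]_N)) 0 i <= a i).
  rewrite !mxE; move: (l%:num) l0 l1 => s s0 s1.
  by apply/andP; split; nra.
- exists (\row_i (a i / 2)); rewrite interior_closed_box// => i; rewrite mxE.
  by have := a0 i; lra.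
Qed.

(** A point [z] of the combined box is the image of the points with the same
    relative position [z i / c i] in the two boxes. *)
Lemma minkowski_comb_closed_box t a b : (forall i, 0 < a i) -> (forall i, 0 < b i) ->
  0 <= t <= 1 ->
  minkowski_comb t (closed_box a) (closed_box b) =
  closed_box (fun i => t * a i + (1 - t) * b i).
Proof.
move=> a0 b0 /andP[t0 t1]; apply/seteqP; split.
  move=> _ [x xK [y yK <-]] i; rewrite !mxE.
  have /andP[? ?] := xK i; have /andP[? ?] := yK i.
  by apply/andP; split; nra.
move=> z zK.
pose c i := t * a i + (1 - t) * b i.
have c0 i : 0 < c i.
  have := a0 i; have := b0 i; rewrite /c; have [->|tn] := eqVneq t 0; first by lra.
  by have : 0 < t by [rewrite lt_neqAle eq_sym tn]; nra.
have zc i : 0 <= z 0 i / c i <= 1.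
  have /andP[z0 z1] := zK i.
  by rewrite (divr_ge0 z0 (ltW (c0 i)))/= ler_pdivrMr// mul1r.
exists (\row_i (a i * (z 0 i / c i))).
  by move=> i; rewrite mxE; have /andP[? ?] := zc i; have ai := a0 i; apply/andP; split; nra.
exists (\row_i (b i * (z 0 i / c i))).
  by move=> i; rewrite mxE; have /andP[? ?] := zc i; have bi := b0 i; apply/andP; split; nra.
apply/rowP => i; rewrite !mxE !mulrA -mulrDl -mulrDl -/(c i).
by rewrite mulrAC divff ?mul1r// gt_eqF.
Qed.

Lemma body_eigenvalue_closed_box a j x : (forall i, 0 < a i) -> (0 < N)%N -> (0 < j)%N ->
  jth_smallest (box_energy a) j x -> body_eigenvalue j (closed_box a) = x.
Proof.
move=> a0 N0 j0 jx; rewrite /body_eigenvalue interior_closed_box//.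
exact: dirichlet_eigenvalue_box.
Qed.

Lemma box_energyZ a s kk : box_energy (fun i => s * a i) kk = s ^- 2 * box_energy a kk.
Proof.
rewrite /box_energy mulr_sumr; apply: eq_bigr => i _.
by rewrite /freq invfM mulrCA exprMn exprVn mulrC.
Qed.

End closed_boxes.

Section functional.
Context {R : realType} {N : nat} (j : nat) (f : R -> R).
Hypotheses (N0 : (0 < N)%N) (j0 : (0 < j)%N).
Hypothesis hf : forall (K L : set 'rV[R]_N) (t : R),
  convex_body K -> convex_body L -> 0 <= t <= 1 ->
  t * f (body_eigenvalue j K) + (1 - t) * f (body_eigenvalue j L)
    <= f (body_eigenvalue j (minkowski_comb t K L)).
Implicit Types a b : 'I_N -> R.

(** The two values of [f] on the left of the hypothesis agree, so they average to
    [f (r * x)]. The factor [r] comes from dilating the boxes by [r ^ (- 1/2)]. *)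
Lemma box_comb_le a b t x y r : (forall i, 0 < a i) -> (forall i, 0 < b i) ->
  0 <= t <= 1 -> 0 < r ->
  jth_smallest (box_energy a) j x -> jth_smallest (box_energy b) j x ->
  jth_smallest (box_energy (fun i => t * a i + (1 - t) * b i)) j y ->
  f (r * x) <= f (r * y).
Proof.
move=> a0 b0 t01 r0 ax bx cy.
pose s := (Num.sqrt r)^-1; have s0 : 0 < s by rewrite invr_gt0 sqrtr_gt0.
have sE : s ^- 2 = r by rewrite /s exprVn invrK sqr_sqrtr// ltW.
have scale (c : 'I_N -> R) z : jth_smallest (box_energy c) j z ->
    jth_smallest (box_energy (fun i => s * c i)) j (r * z).
  apply: (@jth_smallest_bij _ _ _ _ id id) => // kk.
  by rewrite box_energyZ sE.
have sa i : 0 < s * a i by rewrite mulr_gt0.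
have sb i : 0 < s * b i by rewrite mulr_gt0.
have c0 i : 0 < t * a i + (1 - t) * b i.
  case/andP: t01 => t0 t1; have := a0 i; have := b0 i.
  have [->|tn] := eqVneq t 0; first by lra.
  by have : 0 < t by [rewrite lt_neqAle eq_sym tn]; nra.
have := hf (convex_body_closed_box sa) (convex_body_closed_box sb) t01.
rewrite minkowski_comb_closed_box//.
rewrite (body_eigenvalue_closed_box sa N0 j0 (scale _ _ ax)).
rewrite (body_eigenvalue_closed_box sb N0 j0 (scale _ _ bx)).
rewrite (_ : (fun i => _) = fun i => s * (t * a i + (1 - t) * b i)); last first.
  by apply/funext => i; ring.
rewrite (body_eigenvalue_closed_box _ N0 j0 (scale _ _ cy)); last first.
  by move=> i; rewrite mulr_gt0.
by rewrite -mulrDl addrC subrK mul1r.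
Qed.

(** The bounds up to [rho1] make [f] nondecreasing. Iterating the bound at [rho0]
    brings the argument below any prescribed positive number without decreasing the
    value of [f]; so any two values are equal. *)
Lemma constant_of_multiplicative_bounds (rho0 rho1 : R) :
  0 < rho0 < 1 -> 1 < rho1 ->
  (forall x, 0 < x -> f x <= f (rho0 * x)) ->
  (forall rho x, 0 < x -> 1 <= rho <= rho1 -> f x <= f (rho * x)) ->
  exists c : R, forall x, 0 < x -> f x = c.
Proof.
move=> /andP[r00 r01] r1 down up.
have mono n : forall x y, 0 < x -> x <= y -> y <= rho1 ^+ n * x -> f x <= f y.
  elim: n => [|n IH] x y x0 xy.
    by rewrite expr0 mul1r => yx; have -> : x = y by apply/eqP; rewrite eq_le xy yx.
  move=> yx; have r10 : 0 < rho1 by lra.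
  have [h|h] := leP y (rho1 * x).
    have -> : y = y / x * x by rewrite divfK// gt_eqF.
    apply: up => //; rewrite ler_pdivrMr// ler_pdivlMr// mul1r xy //=.
  have xy' : x <= y / rho1 by rewrite ler_pdivlMr// mulrC ltW.
  apply: (@le_trans _ _ (f (y / rho1))).
    apply: IH => //; rewrite ler_pdivrMr//; apply: (le_trans yx).
    by rewrite exprSr -mulrA [rho1 * x]mulrC mulrA.
  have := up rho1 (y / rho1); rewrite [rho1 * _]mulrC divfK ?gt_eqF//; apply.
    exact: lt_le_trans xy'.
  by rewrite lexx (ltW r1).
have small_pow (z e : R) : 0 < z < 1 -> 0 < e -> exists n, z ^+ n <= e.
  move=> /andP[z0 z1] e0.
  have : z ^+ n @[n --> \oo] --> (0 : R) by apply: cvg_expr; rewrite gtr0_norm.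
  move=> /cvgrPdist_le /(_ e e0) [n _ /(_ n (leqnn n))] /=.
  by rewrite sub0r normrN gtr0_norm ?exprn_gt0// => h; exists n.
have grow x y : 0 < x -> x <= y -> exists n, y <= rho1 ^+ n * x.
  move=> x0 xy; have y0 : 0 < y by exact: lt_le_trans xy.
  have [||n h] := small_pow rho1^-1 (x / y).
  - by rewrite invr_gt0 invf_lt1 ?r1 ?andbT; lra.
  - exact: divr_gt0.
  exists n; move: h; rewrite ler_pdivlMr// exprVn ler_pdivrMl//.
  by rewrite exprn_gt0//; lra.
have incr x y : 0 < x -> x <= y -> f x <= f y.
  by move=> x0 xy; have [n] := grow x y x0 xy; exact: mono.
have downn n x : 0 < x -> f x <= f (rho0 ^+ n * x).
  move=> x0; elim: n => [|n IH]; first by rewrite expr0 mul1r.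
  by apply: (le_trans IH); rewrite exprS -mulrA; apply: down; rewrite mulr_gt0// exprn_gt0.
have shrink x y : 0 < x -> 0 < y -> exists n, rho0 ^+ n * y <= x.
  move=> x0 y0; have [||n h] := small_pow rho0 (x / y).
  - by rewrite r00.
  - exact: divr_gt0.
  by exists n; rewrite -ler_pdivlMr.
exists (f 1) => x x0; apply/eqP; rewrite eq_le.
have key u v : 0 < u -> 0 < v -> f u <= f v.
  move=> u0 v0; have [n h] := shrink v u v0 u0.
  by apply: (le_trans (downn n u u0)); apply: incr => //; rewrite mulr_gt0// exprn_gt0.
by rewrite !key.
Qed.
End functional.

(** * Boxes on which the inequality moves the eigenvalue *)

Section low_modes.
Context {R : realType} {N : nat}.
Variables (a : 'I_N -> R) (i0 : 'I_N).
Hypothesis a0 : forall i, 0 < a i.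
Local Notation T := {ffun 'I_N -> nat}.

Lemma box_energyE kk : box_energy a kk = \sum_i (kk i).+1%:R ^+ 2 * (pi / a i) ^+ 2.
Proof. by apply: eq_bigr => i _; rewrite /freq -mulrA exprMn. Qed.

Lemma box_energy_ge kk i : (pi / a i) ^+ 2 <= box_energy a kk.
Proof.
rewrite box_energyE (bigD1 i)//=.
apply: (@le_trans _ _ ((kk i).+1%:R ^+ 2 * (pi / a i) ^+ 2)).
  by rewrite ler_peMl ?sqr_ge0// -natrX ler1n expn_gt0.
by rewrite lerDl sumr_ge0// => l _; rewrite mulr_ge0 ?sqr_ge0.
Qed.

Lemma le_box_energy (kk kk' : T) : (forall i, (kk i <= kk' i)%N) ->
  box_energy a kk <= box_energy a kk'.
Proof.
move=> h; rewrite !box_energyE; apply: ler_sum => i _.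
by rewrite ler_wpM2r ?sqr_ge0// -!natrX ler_nat leq_exp2r// ltnS.
Qed.

Definition mode (i : 'I_N) (k : nat) : T := [ffun l => if l == i then k else 0%N].

Lemma box_energy_mode i k : box_energy a (mode i k) =
  \sum_l (pi / a l) ^+ 2 + (k.+1%:R ^+ 2 - 1) * (pi / a i) ^+ 2.
Proof.
rewrite box_energyE (bigD1 i)//= [X in _ = X + _](bigD1 i)//= ffunE eqxx.
rewrite (eq_bigr (fun l => (pi / a l) ^+ 2)); first by ring.
by move=> l /negbTE li; rewrite ffunE li expr1n mul1r.
Qed.

(** The modes [mode i0 k] with [k <= m] are the [m + 1] lowest ones. Every other mode
    either has more than [m + 1] half waves along [i0], or is excited along some
    other side, none of which is longer than that of [i1]; so the next energy is the
    smaller of those of [mode i0 m.+1] and of [mode i1 1]. *)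
Lemma jth_smallest_thin (i1 : 'I_N) m : i1 != i0 ->
  (forall i, i != i0 -> a i <= a i1) ->
  (m.+1%:R ^+ 2 - 1) * (pi / a i0) ^+ 2 <= 3 * (pi / a i1) ^+ 2 ->
  jth_smallest (box_energy a) m.+2
    (\sum_l (pi / a l) ^+ 2 +
     Num.min ((m.+2%:R ^+ 2 - 1) * (pi / a i0) ^+ 2) (3 * (pi / a i1) ^+ 2)).
Proof.
move=> i10 ai1 hm.
set W := \sum_l _; set x := W + _.
have mode_inj : injective (mode i0).
  by move=> k l /ffunP/(_ i0); rewrite !ffunE eqxx.
pose A := [seq mode i0 k | k <- iota 0 m.+1].
have E1 : box_energy a (mode i0 m.+1) = W + (m.+2%:R ^+ 2 - 1) * (pi / a i0) ^+ 2.
  exact: box_energy_mode.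
have E2 : box_energy a (mode i1 1) = W + 3 * (pi / a i1) ^+ 2.
  by rewrite box_energy_mode -/W; congr (_ + _ * _); rewrite -natrX; lra.
have xE : x = Num.min (box_energy a (mode i0 m.+1)) (box_energy a (mode i1 1)).
  by rewrite E1 E2 -addr_minr.
have lo t : t \in A -> box_energy a t <= x.
  move=> /mapP[k]; rewrite mem_iota add0n ltnS => /= km ->.
  rewrite xE le_min; apply/andP; split.
    by apply: le_box_energy => i; rewrite !ffunE; case: ifP => // _; exact: leqW.
  rewrite E2; apply: (@le_trans _ _ (box_energy a (mode i0 m))).
    by apply: le_box_energy => i; rewrite !ffunE; case: ifP.
  by rewrite box_energy_mode -/W lerD2l.
have hi t : t \notin A -> x <= box_energy a t.
  move=> tA; rewrite xE ge_min.
  have [/existsP[i /andP[ii0 ti]]|] := boolP [exists i, (i != i0) && (0 < t i)%N].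
    apply/orP; right; rewrite E2.
    apply: (@le_trans _ _ (box_energy a (mode i 1))).
      rewrite box_energy_mode -/W; have -> : (2%:R ^+ 2 - 1 : R) = 3 by rewrite -natrX; lra.
      have h : pi / a i1 <= pi / a i by rewrite ler_pM2l ?pi_gt0// lef_pV2 ?posrE ?ai1.
      rewrite lerD2l ler_pM2l// lerXn2r ?nnegrE//; first by rewrite divr_ge0 ?pi_ge0// ltW.
      by rewrite divr_ge0 ?pi_ge0// ltW.
    by apply: le_box_energy => l; rewrite ffunE; case: eqP => // ->.
  rewrite negb_exists => /forallP h; apply/orP; left.
  have tE : t = mode i0 (t i0).
    apply/ffunP => i; rewrite ffunE; case: eqP => [->//|/eqP ii0].
    by have := h i; rewrite ii0 /= -leqNgt leqn0 => /eqP.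
  apply: le_box_energy => i; rewrite ffunE; case: eqP => // ->.
  rewrite leqNgt; apply: contra tA => tm; rewrite tE; apply: map_f.
  by rewrite mem_iota.
have uA t : t \notin A -> uniq (t :: A).
  by move=> tA; rewrite cons_uniq tA map_inj_uniq// iota_uniq.
have sA : (size A).+1 = m.+2 by rewrite size_map size_iota.
have [le12|le21] := leP (box_energy a (mode i0 m.+1)) (box_energy a (mode i1 1)).
  exists A, (mode i0 m.+1); split=> //; last by rewrite xE min_l.
  by apply: uA; rewrite mem_map// mem_iota /= add0n ltnn.
exists A, (mode i1 1); split=> //; last by rewrite xE min_r// ltW.
apply: uA; apply/negP => /mapP[k _ /ffunP/(_ i1)].
by rewrite !ffunE eqxx (negbTE i10).
Qed.

Lemma jth_smallest_ge j x i : jth_smallest (box_energy a) j x -> (pi / a i) ^+ 2 <= x.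
Proof. by move=> [A [t [_ _ <- _ _]]]; exact: box_energy_ge. Qed.

End low_modes.

Lemma jth_smallest_perm {R : realType} {N : nat} (a : 'I_N -> R) (s : {perm 'I_N}) j x :
  jth_smallest (box_energy a) j x -> jth_smallest (box_energy (a \o s)) j x.
Proof.
move=> jx; rewrite -[x]mul1r.
apply: (@jth_smallest_bij _ _ (box_energy a) _
  (fun kk => [ffun i => kk (s i)]) (fun kk => [ffun i => kk ((s^-1)%g i)])) jx => //.
- by move=> kk; apply/ffunP => i; rewrite !ffunE permKV.
- by move=> kk; apply/ffunP => i; rewrite !ffunE permK.
- move=> kk; rewrite mul1r /box_energy [RHS](reindex_inj (@perm_inj _ s)).
  by apply: eq_bigr => i _; rewrite ffunE.
Qed.

Section crossing.
Context {R : realType} {N : nat} (m : nat).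
Variables i0 i1 : 'I_N.
Hypothesis i10 : i1 != i0.

Definition sides (p q c : R) (i : 'I_N) : R :=
  if i == i0 then p else if i == i1 then q else c.

Lemma sides_gt0 p q c : 0 < p -> 0 < q -> 0 < c -> forall i, 0 < sides p q c i.
Proof. by move=> p0 q0 c0 i; rewrite /sides; case: ifP => // _; case: ifP. Qed.

Lemma sides_comb t p q p' q' c :
  (fun i => t * sides p q c i + (1 - t) * sides p' q' c i) =
  sides (t * p + (1 - t) * p') (t * q + (1 - t) * q') c.
Proof.
apply/funext => i; rewrite /sides; case: ifP => // _; case: ifP => // _; ring.
Qed.

(* the rank of the eigenvalue; [B] is determined by equating the energies of the
   modes [(J, 1)] and [(1, 2)] on a rectangle with sides [aspect] and [1]: in units of
   [pi ^+ 2], they are [J ^+ 2 * B + 1] and [B + 4] *)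
Let J : R := m.+2%:R.
Let B : R := 3 / (J ^+ 2 - 1).

Let J2 : 2 <= J. Proof. by rewrite /J ler_nat. Qed.
Let J3 : 3 <= J ^+ 2 - 1. Proof. by move: J2; nra. Qed.
Let B0 : 0 < B. Proof. by rewrite divr_gt0//; move: J3; lra. Qed.
Let B1 : B <= 1. Proof. by rewrite ler_pdivrMr ?mul1r//; move: J3; lra. Qed.
Let JB : (J ^+ 2 - 1) * B = 3.
Proof. by rewrite /B mulrC divfK// gt_eqF//; move: J3; lra. Qed.

(** The aspect ratio at which the energies of the two modes cross. *)
Definition aspect : R := Num.sqrt B^-1.

Lemma aspect_gt0 : 0 < aspect. Proof. by rewrite sqrtr_gt0 invr_gt0. Qed.

Let aspectV2 : (aspect ^+ 2)^-1 = B.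
Proof. by rewrite sqr_sqrtr ?invrK// invr_ge0 ltW. Qed.

Definition thin_part : R := \sum_(i | (i != i0) && (i != i1)) (pi / 2^-1) ^+ 2.

(** The energy of a mode that is not excited along the thin sides, [v] being the
    contribution of the two other sides in units of [pi ^+ 2]. *)
Definition thin_eigenvalue v : R := pi ^+ 2 * v + thin_part.

Let pi2_gt0 : 0 < pi ^+ 2 :> R. Proof. by rewrite exprn_gt0// pi_gt0. Qed.

Let thin_part_ge0 : 0 <= thin_part.
Proof. by rewrite sumr_ge0// => i _; exact: sqr_ge0. Qed.

Lemma thin_eigenvalue_gt0 v : 0 < v -> 0 < thin_eigenvalue v.
Proof. by move=> v0; rewrite ltr_wpDr// mulr_gt0. Qed.

Lemma lt_thin_eigenvalue u v : (thin_eigenvalue u < thin_eigenvalue v) = (u < v).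
Proof. by rewrite ltrD2r ltr_pM2l. Qed.

Lemma le_thin_eigenvalue u v : (thin_eigenvalue u <= thin_eigenvalue v) = (u <= v).
Proof. by rewrite lerD2r ler_pM2l. Qed.

Lemma jth_smallest_sides p q : 0 < p -> 2^-1 <= q ->
  ((J - 1) ^+ 2 - 1) * (B * (p^-1) ^+ 2) <= 3 * (q^-1) ^+ 2 ->
  jth_smallest (box_energy (sides (aspect * p) q 2^-1)) m.+2
    (thin_eigenvalue (B * (p^-1) ^+ 2 + (q^-1) ^+ 2 +
                      3 * Num.min ((p^-1) ^+ 2) ((q^-1) ^+ 2))).
Proof.
move=> p0 q2 cond.
have half0 : 0 < 2^-1 :> R by rewrite invr_gt0.
have ap : 0 < aspect * p by rewrite mulr_gt0// aspect_gt0.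
have s0 := sides_gt0 ap (lt_le_trans half0 q2) half0.
have sE0 : sides (aspect * p) q 2^-1 i0 = aspect * p by rewrite /sides eqxx.
have sE1 : sides (aspect * p) q 2^-1 i1 = q by rewrite /sides (negbTE i10) eqxx.
have w0 : (pi / (aspect * p)) ^+ 2 = pi ^+ 2 * (B * (p^-1) ^+ 2).
  by rewrite -aspectV2 invfM !exprMn !exprVn.
have w1 : (pi / q) ^+ 2 = pi ^+ 2 * (q^-1) ^+ 2 by rewrite exprMn.
have J1E : m.+1%:R = J - 1 by rewrite /J -(natr1 m.+1) addrK.
have := @jth_smallest_thin R N (sides (aspect * p) q 2^-1) i0 s0 i1 m i10.
rewrite sE0 sE1 w0 w1 J1E -/J => H.
have {H} := H _ _.
rewrite (bigD1 i0)//= (bigD1 i1)//= sE0 sE1 w0 w1.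
rewrite (eq_bigr (fun=> (pi / 2^-1) ^+ 2)); last first.
  by move=> i /andP[/negbTE h1 /negbTE h2]; rewrite /sides h1 h2.
rewrite -/thin_part mulrCA [X in Num.min X](_ : _ = pi ^+ 2 * 3 * (p^-1) ^+ 2); last first.
  by rewrite -JB; ring.
rewrite [3 * _](_ : _ = pi ^+ 2 * 3 * (q^-1) ^+ 2); last by ring.
rewrite -minr_pMr; last by rewrite mulr_ge0// ltW.
have -> : thin_eigenvalue (B * (p^-1) ^+ 2 + (q^-1) ^+ 2 +
                           3 * Num.min ((p^-1) ^+ 2) ((q^-1) ^+ 2)) =
    pi ^+ 2 * (B * (p^-1) ^+ 2) + (pi ^+ 2 * (q^-1) ^+ 2 + thin_part) +
    pi ^+ 2 * 3 * Num.min ((p^-1) ^+ 2) ((q^-1) ^+ 2).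
  by rewrite /thin_eigenvalue; ring.
apply.
- by move=> i ii0; rewrite /sides (negbTE ii0); case: ifP.
- by rewrite -mulrA ler_pM2l.
Qed.

Let le_sqr_inv (x y : R) : 0 < y -> y <= x -> (x^-1) ^+ 2 <= (y^-1) ^+ 2.
Proof.
move=> y0 yx; have x0 := lt_le_trans y0 yx.
have h : x^-1 <= y^-1 by rewrite lef_pV2 ?posrE.
by rewrite lerXn2r ?nnegrE// invr_ge0 ltW.
Qed.

(** Energies as functions of the deformation [x]: one of the two main sides is
    multiplied by [1 + x], the other one by [1 - x]. *)
Definition profile (k1 k2 x : R) : R := k1 * ((1 + x)^-1) ^+ 2 + k2 * ((1 - x)^-1) ^+ 2.

Lemma profile0 k1 k2 : profile k1 k2 0 = k1 + k2.
Proof. by rewrite /profile addr0 subr0 invr1 expr1n !mulr1. Qed.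

Lemma profile_IVT (k1 k2 e v : R) : 0 < e < 1 ->
  profile k1 k2 e <= v <= profile k1 k2 0 ->
  exists2 x, 0 <= x <= e & profile k1 k2 x = v.
Proof.
move=> /andP[e0 e1] /andP[v1 v2].
have [| |x] := @IVT R (profile k1 k2) 0 e v (ltW e0).
- apply: continuous_in_subspaceT => x; rewrite inE /= in_itv /= => /andP[x0 xe].
  have c1 : (1 + y)^-1 @[y --> x] --> (1 + x)^-1.
    apply: cvgV; first by rewrite gt_eqF//; lra.
    by apply: cvgD; [exact: cvg_cst|exact: cvg_id].
  have c2 : (1 - y)^-1 @[y --> x] --> (1 - x)^-1.
    apply: cvgV; first by rewrite gt_eqF//; lra.
    by apply: cvgB; [exact: cvg_cst|exact: cvg_id].
  by apply: cvgD; apply: cvgMl_tmp; [exact: (cvgM c1 c1)|exact: (cvgM c2 c2)].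
- by rewrite ge_min le_max v1 v2 orbT.
by rewrite in_itv /= => xI <-; exists x.
Qed.

(** Lengthening the first side favours the mode with many half waves along it.
    Since the thin sides have length [1/2], the second side may shrink to
    [1 - 1/8]. *)
Lemma jth_smallest_stretched e : 0 <= e <= 8^-1 ->
  jth_smallest (box_energy (sides (aspect * (1 + e)) (1 - e) 2^-1)) m.+2
    (thin_eigenvalue (profile (3 + B) 1 e)).
Proof.
move=> /andP[e0 e1].
have p0 : 0 < 1 + e by lra.
have q0 : 0 < 1 - e by lra.
have pq : ((1 + e)^-1) ^+ 2 <= ((1 - e)^-1) ^+ 2 by apply: le_sqr_inv => //; lra.
have := @jth_smallest_sides (1 + e) (1 - e) p0; rewrite min_l// => H.
rewrite (_ : profile _ _ _ = B * (1 + e)^-1 ^+ 2 + (1 - e)^-1 ^+ 2 + 3 * (1 + e)^-1 ^+ 2).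
  apply: H; first by lra.
  have : ((J - 1) ^+ 2 - 1) * B <= 3 by rewrite -JB ler_pM2r//; move: J2; nra.
  have := sqr_ge0 (1 + e)^-1.
  move: ((1 + e)^-1 ^+ 2) ((1 - e)^-1 ^+ 2) pq => P Q PQ P0 hB.
  rewrite mulrA; apply: (@le_trans _ _ (3 * P)); first by rewrite ler_wpM2r.
  by rewrite ler_pM2l.
by rewrite /profile; ring.
Qed.

(* the largest deformation for which the modes [(k, 1)] with [k < J] surely stay
   below [(1, 2)] *)
Let d1 : R := (4 * J)^-1.

Let d1_gt0 : 0 < d1. Proof. by rewrite invr_gt0; move: J2; lra. Qed.

Let Jd1 : J * d1 = 4^-1.
Proof. by rewrite /d1; field; rewrite gt_eqF//; move: J2; lra. Qed.

Let d1_le : d1 <= 8^-1. Proof. by move: J2 Jd1 d1_gt0; nra. Qed.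

(** Shortening the first side favours the mode excited along the second one. *)
Lemma jth_smallest_squeezed d : 0 <= d <= d1 ->
  jth_smallest (box_energy (sides (aspect * (1 - d)) (1 + d) 2^-1)) m.+2
    (thin_eigenvalue (profile 4 B d)).
Proof.
move=> /andP[dge0 dd1].
have d8 := le_trans dd1 d1_le.
have p0 : 0 < 1 - d by lra.
have q0 : 0 < 1 + d by lra.
have pq : ((1 + d)^-1) ^+ 2 <= ((1 - d)^-1) ^+ 2 by apply: le_sqr_inv => //; lra.
have := @jth_smallest_sides (1 - d) (1 + d) p0; rewrite min_r// => H.
rewrite (_ : profile _ _ _ = B * (1 - d)^-1 ^+ 2 + (1 + d)^-1 ^+ 2 + 3 * (1 + d)^-1 ^+ 2).
  apply: H; first by lra.
  have key : ((J - 1) ^+ 2 - 1) * (1 + d) ^+ 2 <= (J ^+ 2 - 1) * (1 - d) ^+ 2.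
    have J0 : 0 <= J by move: J2; lra.
    have Jd : J * d <= 4^-1 by rewrite -Jd1 ler_wpM2l.
    have h1 : 0 <= J * (4^-1 - J * d) by rewrite mulr_ge0// subr_ge0.
    have h2 : 0 <= d ^+ 2 * (2 * J - 1).
      by apply: mulr_ge0; [exact: sqr_ge0|move: J2; lra].
    have h3 : 0 <= J * d by rewrite mulr_ge0.
    by rewrite -subr_ge0; move: J2; nra.
  have -> : ((J - 1) ^+ 2 - 1) * (B * (1 - d)^-1 ^+ 2) =
      B * ((((J - 1) ^+ 2 - 1) * (1 + d) ^+ 2) * ((1 - d)^-1 * (1 + d)^-1) ^+ 2).
    by field; rewrite !gt_eqF.
  have -> : 3 * (1 + d)^-1 ^+ 2 =
      B * (((J ^+ 2 - 1) * (1 - d) ^+ 2) * ((1 - d)^-1 * (1 + d)^-1) ^+ 2).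
    by rewrite -JB; field; rewrite !gt_eqF.
  by rewrite ler_pM2l// ler_wpM2r// sqr_ge0.
by rewrite /profile; ring.
Qed.

Lemma stretched_profile_lt : profile (3 + B) 1 8^-1 < 4 + B.
Proof.
have -> : profile (3 + B) 1 8^-1 = (3 + B) * (64 / 81) + 64 / 49 by rewrite /profile; field.
by move: B0 B1; lra.
Qed.

Lemma squeezed_profile_lt : profile 4 B d1 < 4 + B.
Proof.
move: d1 d1_gt0 d1_le => d d0 d8.
have x1 : (1 + d)^-1 <= 1 - 8 / 9 * d.
  by rewrite -[_^-1]mul1r ler_pdivrMr; [nra|lra].
have y1 : (1 - d)^-1 <= 1 + 8 / 7 * d.
  by rewrite -[_^-1]mul1r ler_pdivrMr; [nra|lra].
have x0 : 0 < (1 + d)^-1 by rewrite invr_gt0; lra.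
have y0 : 0 < (1 - d)^-1 by rewrite invr_gt0; lra.
have x2 : ((1 + d)^-1) ^+ 2 <= (1 - 8 / 9 * d) ^+ 2.
  by rewrite lerXn2r// nnegrE ltW// (lt_le_trans x0).
have y2 : ((1 - d)^-1) ^+ 2 <= (1 + 8 / 7 * d) ^+ 2.
  by rewrite lerXn2r// nnegrE ltW// (lt_le_trans y0).
have y3 : B * ((1 - d)^-1) ^+ 2 <= B * (1 + 8 / 7 * d) ^+ 2 by rewrite ler_pM2l.
apply: (@le_lt_trans _ _ (4 * (1 - 8 / 9 * d) ^+ 2 + B * (1 + 8 / 7 * d) ^+ 2)).
  by rewrite /profile; lra.
have : B * (16 / 7 * d + 64 / 49 * d ^+ 2) <= 16 / 7 * d + 64 / 49 * d ^+ 2.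
  by rewrite ler_piMl//; nra.
by nra.
Qed.

(** At the crossing the two profiles have the value [4 + B], and both are lower after
    their deformation. Each [v] slightly below is thus reached along both
    deformations, by the intermediate value theorem, and the weight [d / (e + d)]
    cancels the deformations [e] and [- d]. *)
Lemma crossing_boxes : exists2 v0, 0 < v0 < 4 + B &
  forall v, v0 <= v < 4 + B -> exists (a b : 'I_N -> R) t,
  [/\ (forall i, 0 < a i) /\ (forall i, 0 < b i), 0 <= t <= 1,
      jth_smallest (box_energy a) m.+2 (thin_eigenvalue v),
      jth_smallest (box_energy b) m.+2 (thin_eigenvalue v) &
      jth_smallest (box_energy (fun i => t * a i + (1 - t) * b i)) m.+2
        (thin_eigenvalue (4 + B))].
Proof.
exists (Num.max (profile (3 + B) 1 8^-1) (profile 4 B d1)).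
  apply/andP; split; last by rewrite gt_max stretched_profile_lt squeezed_profile_lt.
  rewrite lt_max /profile; apply/orP; left; apply: addr_gt0.
    by apply: mulr_gt0; [move: B0; lra|rewrite exprn_gt0// invr_gt0; lra].
  by apply: mulr_gt0; [lra|rewrite exprn_gt0// invr_gt0; lra].
move=> v; rewrite ge_max => /andP[/andP[v1 v2] v3].
have [||e /andP[e0 e8] pe] := @profile_IVT (3 + B) 1 8^-1 v.
- by lra.
- by rewrite v1 profile0; move: v3; lra.
have [||d /andP[d0 dd] pd] := @profile_IVT 4 B d1 v.
- by rewrite d1_gt0 (le_lt_trans d1_le)//; lra.
- by rewrite v2 profile0 ltW.
have d8 := le_trans dd d1_le.
have hK := @jth_smallest_stretched e; rewrite e0 e8 pe in hK.
have hL := @jth_smallest_squeezed d; rewrite d0 dd pd in hL.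
(* [v] is below the value at the crossing, so the deformation is not trivial *)
have {}e0 : 0 < e.
  rewrite lt_neqAle e0 andbT eq_sym; apply: contraTneq v3 => ez.
  by rewrite -pe ez profile0 -leNgt; lra.
have ed : 0 < e + d by lra.
pose t := d / (e + d).
have tE : t * e = (1 - t) * d by rewrite /t; field; rewrite gt_eqF.
have half0 : 0 < 2^-1 :> R by rewrite invr_gt0.
exists (sides (aspect * (1 + e)) (1 - e) 2^-1),
  (sides (aspect * (1 - d)) (1 + d) 2^-1), t; split.
- split; apply: sides_gt0 => //; try (by apply: mulr_gt0; [exact: aspect_gt0|lra]);
    lra.
- by rewrite divr_ge0 ?(ltW ed)//= ler_pdivrMr// mul1r lerDr ltW.
- exact: hK.
- exact: hL.
rewrite sides_comb.
rewrite (_ : t * (aspect * (1 + e)) + (1 - t) * (aspect * (1 - d)) = aspect * (1 + 0)); last first.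
  transitivity (aspect * (1 + (t * e - (1 - t) * d))); first by ring.
  by rewrite tE subrr.
rewrite (_ : t * (1 - e) + (1 - t) * (1 + d) = 1 - 0); last first.
  transitivity (1 - (t * e - (1 - t) * d)); first by ring.
  by rewrite tE subrr.
rewrite (_ : 4 + B = profile (3 + B) 1 0); last by rewrite profile0; ring.
by apply: jth_smallest_stretched; lra.
Qed.

End crossing.

Section constancy.
Context {R : realType} {N : nat} (m : nat) (f : R -> R).
Variables i0 i1 : 'I_N.
Hypothesis i10 : i1 != i0.
Hypothesis hf : forall (K L : set 'rV[R]_N) (t : R),
  convex_body K -> convex_body L -> 0 <= t <= 1 ->
  t * f (body_eigenvalue m.+2 K) + (1 - t) * f (body_eigenvalue m.+2 L)
    <= f (body_eigenvalue m.+2 (minkowski_comb t K L)).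

Let N0 : (0 < N)%N. Proof. exact: leq_ltn_trans (ltn_ord i0). Qed.

(** [u] is chosen so small that the single energy [(pi / u) ^+ 2] exceeds the
    [j]-th eigenvalue [y] of the unit cube. *)
Lemma expand_down : exists2 rho : R, 0 < rho < 1 & forall x, 0 < x -> f x <= f (rho * x).
Proof.
have [y hy] := jth_smallest_exists
  (finite_sublevels_box_energy (a := fun=> 1 : R) (fun=> ltr01))
  (infinite_mode_set N0) (ltn0Sn m.+1).
have pi1 : 1 <= pi :> R by have := pi_ge2 R; lra.
have y0 : 0 < y.
  have h := @jth_smallest_ge R N (fun=> 1) m.+2 y i0 hy; apply: lt_le_trans h.
  by rewrite exprn_gt0// divr_gt0// pi_gt0.
pose u := (1 + y)^-1.
have u0 : 0 < u by rewrite invr_gt0; lra.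
have u1 : u < 1 by rewrite invf_lt1; lra.
pose aK := sides i0 i1 (2 - u) u 1; pose aL := sides i0 i1 u (2 - u) 1.
have aK0 i : 0 < aK i by apply: sides_gt0 => //; lra.
have aL0 i : 0 < aL i by apply: sides_gt0 => //; lra.
have [x hx] := jth_smallest_exists (finite_sublevels_box_energy aK0)
  (infinite_mode_set N0) (ltn0Sn m.+1).
have hx' : jth_smallest (box_energy aL) m.+2 x.
  have -> : aL = aK \o tperm i0 i1.
    apply/funext => i; rewrite /aL /aK /sides /=; case: tpermP => [->|->|].
    - by rewrite eqxx (negbTE i10) eqxx.
    - by rewrite (negbTE i10) !eqxx.
    - by move=> /eqP/negbTE-> /eqP/negbTE->.
  exact: jth_smallest_perm.
have yx : y < x.
  have := jth_smallest_ge i1 hx; apply: lt_le_trans.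
  rewrite /aK /sides (negbTE i10) eqxx /u invrK.
  have : (1 + y) ^+ 2 <= (pi * (1 + y)) ^+ 2.
    by rewrite lerXn2r ?nnegrE ?ler_peMl// ?mulr_ge0 ?pi_ge0//; lra.
  by nra.
have x0 : 0 < x by exact: lt_trans yx.
exists (y / x); first by rewrite divr_gt0//= ltr_pdivrMr// mul1r.
move=> z z0.
have half01 : 0 <= (2^-1 : R) <= 1 by lra.
have hy' : jth_smallest (box_energy (fun i => 2^-1 * aK i + (1 - 2^-1) * aL i)) m.+2 y.
  rewrite /aK /aL sides_comb (_ : sides _ _ _ _ _ = fun=> 1)//.
  by apply/funext => i; rewrite /sides; case: ifP => _; [|case: ifP => _]; field.
have zx : 0 < z / x by exact: divr_gt0.
have := box_comb_le N0 (ltn0Sn m.+1) hf aK0 aL0 half01 zx hx hx' hy'.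
by rewrite divfK ?gt_eqF// (_ : z / x * y = y / x * z)//; ring.
Qed.

(** The [j]-th eigenvalue of the crossing box, divided by that of the deformed
    ones: as the deformations shrink to zero, this ratio takes all the values down to [1]. *)
Lemma expand_up : exists2 rho1 : R, 1 < rho1 &
  forall rho x, 0 < x -> 1 <= rho <= rho1 -> f x <= f (rho * x).
Proof.
have [v0 /andP[v00 v0V] boxes] := @crossing_boxes R N m i0 i1 i10.
set V := 4 + _ in v0V boxes; set lam := @thin_eigenvalue R N i0 i1 in boxes.
have lam0 v : 0 < v -> 0 < lam v by exact: thin_eigenvalue_gt0.
have V0 : 0 < V := lt_trans v00 v0V.
exists (lam V / lam v0).
  by rewrite ltr_pdivlMr ?lam0// mul1r lt_thin_eigenvalue.
move=> rho x x0 /andP[]; rewrite le_eqVlt => /predU1P[<- _|rho1 rhoV].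
  by rewrite mul1r.
have rho0 : 0 < rho := lt_trans ltr01 rho1.
pose v := (lam V / rho - thin_part i0 i1) / pi ^+ 2.
have lamv : lam v = lam V / rho.
  by rewrite /lam /thin_eigenvalue mulrC divfK ?subrK// gt_eqF// exprn_gt0// pi_gt0.
have vV : v0 <= v < V.
  rewrite -(le_thin_eigenvalue i0 i1) -(lt_thin_eigenvalue i0 i1) -/lam lamv.
  rewrite ler_pdivlMr// mulrC -ler_pdivlMr ?lam0// rhoV /=.
  by rewrite ltr_pdivrMr// ltr_pMr ?lam0.
have lv0 : 0 < lam v by apply: lam0; have /andP[h _] := vV; exact: lt_le_trans h.
have [a [b [t [[a0 b0] t01 ha hb hab]]]] := boxes v vV.
have := box_comb_le N0 (ltn0Sn m.+1) hf a0 b0 t01 (divr_gt0 x0 lv0) ha hb hab.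
rewrite divfK ?gt_eqF// (_ : x / lam v * lam V = rho * x)//.
by rewrite lamv; field; rewrite !gt_eqF// lam0.
Qed.

Lemma constant_functional : exists c : R, forall x, 0 < x -> f x = c.
Proof.
have [rho h0 down] := expand_down; have [rho1 h1 up] := expand_up.
exact: constant_of_multiplicative_bounds h0 h1 down up.
Qed.

End constancy.

Theorem theorem3 (R : realType) (j N : nat) (hj : (2 <= j)%N) (hN : (2 <= N)%N)
    (f : R -> R)
    (hf : forall (K L : set 'rV[R]_N) (t : R),
        convex_body K -> convex_body L -> 0 <= t <= 1 ->
        t * f (body_eigenvalue j K) + (1 - t) * f (body_eigenvalue j L)
          <= f (body_eigenvalue j (minkowski_comb t K L))) :
  exists c : R, forall x : R, 0 < x -> f x = c.
Proof.
case: j hj hf => [//|[//|m]] _ hf.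
exact: (@constant_functional R N m f (Ordinal (ltnW hN)) (Ordinal hN)).
Qed.
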